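(* Let $G$ be a finite simple graph such that every induced subgraph $H$ of $G$ satisfies $|E(H)| \le 2|V(H)| - 1$. Then $a'(G) \le \Delta(G) + 3$, where $\Delta(G)$ is the maximum degree of $G$.
   Context: An acyclic edge coloring of a graph is a proper edge coloring (adjacent edges receive distinct colors) in which there is no bichromatic cycle, i.e. no cycle whose edges use only two colors. The acyclic chromatic index $a'(G)$ is the minimum number of colors in an acyclic edge coloring of $G$. *)

(* Defs.v *)
From mathcomp Require Import all_boot.
Set Implicit Arguments. Unset Strict Implicit. Unset Printing Implicit Defensive.

Section Graph.
Variable T : finType.
Variable e : rel T.

Definition simple_graph : Prop := symmetric e /\ irreflexive e.

Definition edges : {set {set T}} :=
  [set [set x; y] | x in T, y in T & e x y].

Definition induced_edges (S : {set T}) : {set {set T}} :=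
  [set f in edges | f \subset S].

Definition degree (v : T) : nat := #|[set u | e v u]|.

Definition max_degree : nat := \max_(v : T) degree v.

Definition proper_edge_coloring (c : {set T} -> nat) : Prop :=
  forall f g, f \in edges -> g \in edges -> f != g ->
    ~~ [disjoint f & g] -> c f != c g.

Definition bichromatic_cycle (c : {set T} -> nat) : Prop :=
  exists p : seq T, [/\ 2 < size p, uniq p, cycle e p &
    exists a b : nat, forall x, x \in p -> c [set x; next p x] \in [:: a; b]].

Definition acyclic_edge_coloring (c : {set T} -> nat) : Prop :=
  proper_edge_coloring c /\ ~ bichromatic_cycle c.

(* a'(G) <= k  iff  G has an acyclic edge coloring with (at most) k colours *)
Definition acyclic_edge_colorable (k : nat) : Prop :=
  exists c : {set T} -> nat,
    (forall f, f \in edges -> c f < k) /\ acyclic_edge_coloring c.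

End Graph.

(* Main.v *)
Require Import Defs.
From mathcomp Require Import all_boot zify.
Set Implicit Arguments. Unset Strict Implicit. Unset Printing Implicit Defensive.

(* Induction on the number of edges, with D + 3 colours where D bounds all degrees.

   The average degree is below 4, so discharging yields a vertex v which has degree 1,
   or has degree 2 and a neighbour with at most three neighbours of degree at least 4,
   or has degree 3 and a neighbour x which has degree 3 or 4, or degree 5 and at least
   four neighbours of degree 3.

   An acyclic coloring g of G - v extends to v exactly when the edges at v receive
   distinct colours, each missing at its other end, and no two neighbours w, w' of v are
   joined in g by a path in the two colours given to vw and vw'.  In degree 3, with
   neighbours x, y, z, an acyclic coloring of G - vx provides colours p, q for vy, vz.
   A colour c is blocked at vx only by a path in c and p (or q) from x to y (or z), so
   that c occurs at y and at the p-neighbour of x.  If all colours are blocked, counting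
   determines the colours seen around v almost completely, and some edges at v or x can
   be recoloured; the new coloring is not blocked because a maximal bichromatic path has
   only two ends. *)

Ltac nat_lia :=
  repeat match goal with
  | H : is_true (leq _ _) |- _ => revert H
  | H : @eq nat _ _ |- _ => revert H
  end;
  repeat match goal with H : _ |- _ => clear H end; intros; lia.

(** * Bichromatic paths and one-vertex extensions *)

Section Coloring.
Variables (T C : finType).
Implicit Types (f g : T -> T -> option C) (a b c p q : C) (x y z u v w : T).

Definition bichrom f a b : rel T :=
  fun x y => (f x y == Some a) || (f x y == Some b).

Definition colors_at f x : {set C} := [set c | [exists y, f x y == Some c]].

(** The value [None] marks a non-edge, so [f] carries its own graph and deletions need no change of
    vertex type. *)
Record acyclic_coloring f : Prop := AcyclicColoring {
  colC : forall x y, f x y = f y x;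
  col_inj : forall x y z c, f x y = Some c -> f x z = Some c -> y = z;
  col_acyclic : forall a b s, uniq s -> 2 < size s ->
    ~~ cycle (bichrom f a b) s }.

Definition delete f v : T -> T -> option C :=
  fun x y => if (x == v) || (y == v) then None else f x y.

Definition extend f v (h : T -> option C) : T -> T -> option C :=
  fun x y => if x == v then h y else if y == v then h x else f x y.

Lemma colors_atP f x c : reflect (exists y, f x y = Some c) (c \in colors_at f x).
Proof. by rewrite inE; apply: (iffP existsP) => -[y H]; exists y; apply/eqP. Qed.

Lemma mem_colors_at f x y c : f x y = Some c -> c \in colors_at f x.
Proof. by move=> H; apply/colors_atP; exists y. Qed.

Lemma bichromC f a b : bichrom f a b =2 bichrom f b a.
Proof. by move=> x y; rewrite /bichrom orbC. Qed.

Lemma connect_bichromC f a b : connect (bichrom f a b) =2 connect (bichrom f b a).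
Proof. exact: eq_connect (bichromC f a b). Qed.

Lemma bichrom_sym f a b : (forall x y, f x y = f y x) -> symmetric (bichrom f a b).
Proof. by move=> fC x y; rewrite /bichrom fC. Qed.

Lemma connect_bichrom_sym f a b x y : (forall x y, f x y = f y x) ->
  connect (bichrom f a b) x y = connect (bichrom f a b) y x.
Proof.
by move=> fC; apply: (sym_connect_sym (bichrom_sym a b fC)).
Qed.

Lemma connect_step (r : rel T) x y : connect r x y -> x != y ->
  exists2 u, r x u & connect r u y.
Proof.
case/connectP=> -[|u s] /=; first by move=> _ ->; rewrite eqxx.
by case/andP=> xu us -> _; exists u => //; apply/connectP; exists s.
Qed.

Lemma notin_bichrom_isolated f a b x y : a \notin colors_at f x ->
  b \notin colors_at f x -> x != y -> ~~ connect (bichrom f a b) x y.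
Proof.
move=> ax bx xy; apply/negP => /connect_step /(_ xy) [u /orP[]/eqP /mem_colors_at H _].
  by rewrite H in ax.
by rewrite H in bx.
Qed.

Lemma connect_sub_bichrom f g a b x y :
  (forall x y c, f x y = Some c -> g x y = Some c) ->
  connect (bichrom f a b) x y -> connect (bichrom g a b) x y.
Proof.
move=> fg; apply: connect_sub => s t /orP[]/eqP /fg H; apply: connect1;
by rewrite /bichrom H eqxx ?orbT.
Qed.

Lemma delete_sub f v x y c : delete f v x y = Some c -> f x y = Some c.
Proof. by rewrite /delete; case: ifP. Qed.

Lemma colors_at_delete_sub f v x : colors_at (delete f v) x \subset colors_at f x.
Proof. by apply/subsetP=> c /colors_atP[y /delete_sub /mem_colors_at]. Qed.

Lemma acyclic_coloring_delete f v :
  acyclic_coloring f -> acyclic_coloring (delete f v).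
Proof.
case=> fC finj fac; split=> [x y|x y z c|a b s us ss].
- by rewrite /delete orbC fC.
- by move=> /delete_sub + /delete_sub; apply: finj.
apply: contra (fac a b s us ss); apply: sub_cycle => x y /orP[]/eqP/delete_sub H;
by rewrite /bichrom H eqxx ?orbT.
Qed.

Lemma path_extend g v h a b x s : x != v -> v \notin s ->
  path (bichrom (extend g v h) a b) x s = path (bichrom g a b) x s.
Proof.
elim: s x => //= y s IH x xv; rewrite inE negb_or eq_sym => /andP[yv vs].
by rewrite IH // /bichrom /extend (negbTE xv) (negbTE yv).
Qed.

(** A bichromatic cycle avoiding [v] already lies in [g]. One through [v] uses two edges at [v], of
    distinct colours, and the rest of it joins their ends in [g], which the last hypothesis
    forbids. *)
Lemma acyclic_coloring_extend g v h : acyclic_coloring g ->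
  (forall w, g v w = None) -> h v = None ->
  (forall w w' p, h w = Some p -> h w' = Some p -> w = w') ->
  (forall w p, h w = Some p -> p \notin colors_at g w) ->
  (forall w w' p q, w != w' -> h w = Some p -> h w' = Some q ->
     ~~ connect (bichrom g p q) w w') ->
  acyclic_coloring (extend g v h).
Proof.
case=> gC ginj gac gv hv hinj hcol hconn.
have eC x y : extend g v h x y = extend g v h y x.
  rewrite /extend gC; case: (eqVneq x v) => [->|xv]; case: (eqVneq y v) => // ->.
  by [].
split=> [//|x y z c|a b s us ss].
- rewrite /extend; case: (eqVneq x v) => [_|xv]; first exact: hinj.
  case: (eqVneq y v) => [->|yv]; case: (eqVneq z v) => [->|zv] //.
  + by move=> /hcol /negP hc /mem_colors_at.
  + by move=> /mem_colors_at H /hcol; rewrite H.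
  exact: ginj.
apply/negP; have [vs|vs] := boolP (v \in s).
  (* Rotate the cycle so that it reads [v], [x], [s'], [y], with both edges at [v] exposed. *)
  case: (rot_to vs) => i s' Es; rewrite -(rot_cycle i) Es.
  move: us ss; rewrite -(rot_uniq i) -(size_rot i s) Es /= => /andP[vs' us'].
  case: s' {Es} vs' us' => [|x s'] //= vs'; case/lastP: s' vs' => [|s' y] //= vs' us' _.
  rewrite rcons_path => /andP[vx /andP[xy yv]]; rewrite last_rcons in yv.
  move: vs'; rewrite inE negb_or => /andP[nvx vs'].
  have nxy : x != y.
    by apply: contraTneq us' => ->; rewrite mem_rcons inE eqxx.
  have yv' : bichrom (extend g v h) a b v y by rewrite bichrom_sym.
  have cxy : connect (bichrom g a b) x y.
    apply/connectP; exists (rcons s' y); last by rewrite last_rcons.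
    by rewrite path_extend // eq_sym in xy.
  move: vx yv'; rewrite /bichrom /extend eqxx => /orP[]/eqP hx /orP[]/eqP hy.
  - by move: nxy; rewrite (hinj _ _ _ hx hy) eqxx.
  - by have := hconn _ _ _ _ nxy hx hy; rewrite cxy.
  - by have := hconn _ _ _ _ nxy hx hy; rewrite connect_bichromC cxy.
  - by move: nxy; rewrite (hinj _ _ _ hx hy) eqxx.
apply/negP; apply: contra (gac a b s us ss); case: s vs us ss => //= x s.
rewrite inE negb_or => /andP[vx vs] _ _; rewrite path_extend //; first by rewrite eq_sym.
by rewrite mem_rcons inE negb_or vx.
Qed.

(** Together with [xu] and [xw], such a path would close a bichromatic cycle of [f] through [x]. *)
Lemma connect_delete_forbidden f x u w p q : acyclic_coloring f ->
  f x u = Some p -> f x w = Some q -> u != w -> u != x ->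
  ~~ connect (bichrom (delete f x) p q) u w.
Proof.
case=> fC finj fac xu xw uw ux; apply/negP.
case/connectP=> s0 /shortenP[s ps us _ {s0}] Ew.
have sx : x \notin u :: s.
  apply/negP => xs.
  have {xs} xs : x \in s by move: xs; rewrite inE eq_sym (negbTE ux).
  case/splitPr: xs us ps Ew => s1 s2 _; rewrite cat_path /= => /and3P[_ + _] _.
  by rewrite /bichrom /delete eqxx !orbT.
have := fac p q (x :: u :: s); rewrite /= sx => /(_ us) /(_ _)/negP; apply.
  by rewrite /= ltnS ltnS lt0n size_eq0; apply: contraNneq uw => s0; rewrite Ew s0.
rewrite {1}/bichrom xu eqxx /= rcons_path -Ew {2}/bichrom fC xw eqxx orbT andbT.
by apply: sub_path ps => y z /orP[]/eqP /delete_sub H; rewrite /bichrom H eqxx ?orbT.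
Qed.

(* A bichromatic path leaving [x] by its only edge never comes back to [x]. *)
Lemma connect_bichrom_leaf f a p x y u : acyclic_coloring f ->
  connect (bichrom f a p) x y -> a \notin colors_at f x -> f x u = Some p -> x != y ->
  connect (bichrom (delete f x) a p) u y.
Proof.
move=> [fC finj fac] /connectP[s0 /shortenP[s ps us _ {s0}] ->] ax xu.
case: s us ps => [|w s]; first by rewrite eqxx.
move=> /= /andP[xs us] /andP[xw ws] _.
have Ew : w = u.
  case/orP: xw => /eqP xw; first by rewrite (mem_colors_at xw) in ax.
  exact: finj xw xu.
subst w; apply/connectP; exists s => //.
move: xs us ws {xw}; elim: s u {xu} => //= w s IH u.
rewrite !inE !negb_or => /and3P[xu xw xs] /andP[_ us] /andP[uw ws].
rewrite IH ?inE ?negb_or ?xw //= andbT /bichrom /delete ![_ == x]eq_sym (negbTE xu) (negbTE xw).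
exact: uw.
Qed.

(** The path leaves [x] by a [p]-edge, as [a] is missing there, and reaches [y] by an [a]-edge.
    Hence the [p]-neighbour of [x] is not [y], and the path continues from it by an [a]-edge. This
    is the basic test for blocked colours. *)
Lemma connect_bichrom_ends f a p x y : acyclic_coloring f ->
  connect (bichrom f a p) x y -> a \notin colors_at f x -> p \notin colors_at f y ->
  x != y ->
  [/\ p \in colors_at f x, a \in colors_at f y &
      forall u, f x u = Some p -> a \in colors_at f u].
Proof.
move=> okf cxy ax py xy; have [fC finj fac] := okf.
have cyx : connect (bichrom f a p) y x by rewrite connect_bichrom_sym.
split.
- case: (connect_step cxy xy) => u /orP[]/eqP /mem_colors_at // H _.
  by rewrite H in ax.
- rewrite eq_sym in xy; case: (connect_step cyx xy) => u /orP[]/eqP /mem_colors_at // H _.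
  by rewrite H in py.
move=> u xu; have uy : u != y.
  by apply: contraNneq py => <-; apply/colors_atP; exists x; rewrite fC.
case: (connect_step (connect_bichrom_leaf okf cxy ax xu xy) uy) => w.
move=> /orP[]/eqP uw _; first exact: mem_colors_at (delete_sub uw).
move: (delete_sub uw) => fuw; rewrite fC in xu.
by move: uw; rewrite (finj _ _ _ _ fuw xu) /delete eqxx orbT.
Qed.

End Coloring.

(* The vertices of a path joining two leaves form a closed set. *)
Lemma connect_three_leaves (T : finType) (r : rel T) (x y z : T) :
  symmetric r ->
  (forall s, #|[set t | r s t]| <= 2) ->
  #|[set t | r x t]| <= 1 -> #|[set t | r y t]| <= 1 -> #|[set t | r z t]| <= 1 ->
  x != y -> x != z -> y != z ->
  connect r x y -> connect r x z -> False.
Proof.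
move=> rC d2 dx dy dz xy xz yz /connectP[s0 /shortenP[s ps us _ {s0}] Ey] cxz.
have le1 w t t' : #|[set t | r w t]| <= 1 -> r w t -> r w t' -> t = t'.
  by move=> /card_le1_eqP H rt rt'; apply: H; rewrite inE.
have le2 w t1 t2 t : r w t1 -> r w t2 -> t1 != t2 -> r w t -> (t == t1) || (t == t2).
  move=> r1 r2 n12 rt; apply: contraT; rewrite negb_or => /andP[n1 n2].
  have : #|[set t; t1; t2]| <= 2.
    apply: leq_trans (subset_leq_card _) (d2 w).
    by apply/subsetP => u; rewrite !inE -orbA => /or3P[]/eqP ->.
  by rewrite -setUA cardsU1 cards2 !inE negb_or n1 n2 n12.
(* A vertex of the path other than its ends has two distinct neighbours on the path; by the degree
   bound these are all its neighbours. *)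
have split w : w \in x :: s -> [\/ w = x, w = y | exists t1 t2,
    [/\ t1 \in x :: s, t2 \in x :: s, t1 != t2, r w t1 & r w t2]].
  rewrite inE => /predU1P[->|ws]; first by constructor 1.
  have [->|wy] := eqVneq w y; first by constructor 2.
  constructor 3; case/splitPr: ws us ps Ey => s1 s2.
  rewrite -cat_cons cat_uniq cat_path last_cat /=.
  case: s2 => [|t s2] /=; first by move=> _ _ /eqP; rewrite eq_sym (negbTE wy).
  case/and3P=> u1 /norP[_ /norP[ts1 _]] _ /and4P[_ lw wt _] _.
  exists (last x s1), t; rewrite !(mem_cat, inE) !eqxx !orbT; split=> //.
  - by have := mem_last x s1; rewrite !inE => /orP[->|->]; rewrite ?orbT.
  - by apply: contraNneq ts1 => <-; rewrite mem_last.
  - by rewrite rC.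
have scl w t : w \in x :: s -> r w t -> t \in x :: s.
  move=> ws wt; case: (split w ws) => [Ew|Ew|[t1 [t2 [s1 s2 n12 r1 r2]]]].
  - case: s us ps Ey {split ws} => [|u s] /=; first by move=> _ _ /eqP; rewrite eq_sym (negbTE xy).
    by move=> _ /andP[xu _] _; subst w; rewrite (le1 _ _ _ dx wt xu) !inE eqxx orbT.
  - case/lastP: s us ps Ey {split ws} => [|s u] /=; first by move=> _ _ /eqP; rewrite eq_sym (negbTE xy).
    rewrite last_rcons rcons_path => _ /andP[_ lu] Eu; subst w u; rewrite rC in lu.
    by rewrite (le1 _ _ _ dy wt lu) -rcons_cons mem_rcons inE mem_last orbT.
  by case/orP: (le2 _ _ _ _ r1 r2 n12 wt) => /eqP ->.
have zs : z \in x :: s.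
  have cl : closed r (mem (x :: s)).
    by apply: (intro_closed (sym_connect_sym rC)) => w t /[swap]; apply: scl.
  by rewrite -(closed_connect cl cxz) mem_head.
case: (split z zs) => [Ez|Ez|[t1 [t2 [_ _ n12 r1 r2]]]].
- by rewrite Ez eqxx in xz.
- by rewrite Ez eqxx in yz.
by rewrite (le1 _ _ _ dz r1 r2) eqxx in n12.
Qed.

Section Ends.
Variables (T C : finType) (f : T -> T -> option C).
Hypothesis okf : acyclic_coloring f.

Lemma card_color_class x a : #|[set t | f x t == Some a]| <= (a \in colors_at f x).
Proof.
have [ax|ax] := boolP (a \in _).
  apply/card_le1_eqP => s t; rewrite !inE => /eqP fs /eqP ft.
  exact: (col_inj okf ft fs).
rewrite leqn0 cards_eq0; apply/eqP/setP => t; rewrite !inE.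
by apply: contraNF ax => /eqP /mem_colors_at.
Qed.

Lemma card_bichrom x a b : #|[set t | bichrom f a b x t]| <=
  (a \in colors_at f x) + (b \in colors_at f x).
Proof.
apply: leq_trans (leq_add (card_color_class x a) (card_color_class x b)).
apply: leq_trans (leq_card_setU _ _); apply: subset_leq_card.
by apply/subsetP => t; rewrite !inE.
Qed.

(* A maximal bichromatic path has only two ends. *)
Lemma bichrom_three_ends a b x y z :
  ~~ ((a \in colors_at f x) && (b \in colors_at f x)) ->
  ~~ ((a \in colors_at f y) && (b \in colors_at f y)) ->
  ~~ ((a \in colors_at f z) && (b \in colors_at f z)) ->
  x != y -> x != z -> y != z ->
  connect (bichrom f a b) x y -> ~~ connect (bichrom f a b) x z.
Proof.
move=> hx hy hz xy xz yz cxy; apply/negP => cxz.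
have le1 w : ~~ ((a \in colors_at f w) && (b \in colors_at f w)) ->
    #|[set t | bichrom f a b w t]| <= 1.
  by move=> hw; apply: leq_trans (card_bichrom w a b) _; case: (_ \in _) hw; case: (_ \in _).
apply: (@connect_three_leaves _ (bichrom f a b) x y z) => //; try exact: le1.
  exact: bichrom_sym (colC okf).
by move=> s; apply: leq_trans (card_bichrom s a b) _; do 2 case: (_ \in _).
Qed.

End Ends.

(** * Vertices of degree at most two *)

Lemma exists_in_notin (C : finType) (A B : {set C}) :
  #|B| < #|A| -> exists2 c, c \in A & c \notin B.
Proof.
move=> ltBA; have /set0Pn[c] : A :\: B != set0.
  by apply: contraTneq ltBA => /eqP; rewrite setD_eq0 -leqNgt => /subset_leq_card.
by rewrite inE => /andP[cB cA]; exists c.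
Qed.

(** Applied with [G] the existence of a coloring: either some colour of [A] succeeds, or every one
    is blocked. *)
Lemma forall_or (C : finType) (A B : pred C) (G : Prop) :
  (forall c, A c -> B c \/ G) -> (forall c, A c -> B c) \/ G.
Proof.
move=> H; have [/existsP[c /andP[Ac Bc]]|/existsPn nB] :=
  boolP [exists c, A c && ~~ B c].
  by right; case: (H c Ac) => // Bc'; rewrite Bc' in Bc.
by left=> c Ac; have := nB c; rewrite Ac negbK.
Qed.

Section Graphs.
Variables (T C : finType).
Implicit Types (f g : T -> T -> option C) (a b c p q r : C) (x y z u v w : T).
Implicit Types (e : rel T).

Definition covers f e := forall x y, (f x y != None) = e x y.

Definition del_vertex e v : rel T := fun x y => [&& x != v, y != v & e x y].

Definition colorable e : Prop :=
  exists f : T -> T -> option C, acyclic_coloring f /\ covers f e.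

Lemma covers_del_vertex f e v : covers f e -> covers (delete f v) (del_vertex e v).
Proof.
move=> fe x y; rewrite /delete /del_vertex -fe; case: (x == v) => //=.
by case: (y == v).
Qed.

Lemma card_colors_at f e x : covers f e -> #|colors_at f x| <= degree e x.
Proof.
move=> fe; rewrite -(card_imset _ (@Some_inj _)).
apply: leq_trans (leq_imset_card (f x) _); apply: subset_leq_card.
apply/subsetP => _ /imsetP[c /colors_atP[y fxy] ->]; rewrite -fxy.
by apply: imset_f; rewrite inE -fe fxy.
Qed.

Lemma degree_del_vertex e v w : degree (del_vertex e v) w + e w v <= degree e w.
Proof.
rewrite /degree [X in _ <= X](cardsD1 v) addnC inE leq_add2l.
apply: subset_leq_card; apply/subsetP => t; rewrite !inE.
by case/and3P=> _ -> ->.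
Qed.

Lemma card_colors_at_del f e v w : covers f (del_vertex e v) ->
  #|colors_at f w| + e w v <= degree e w.
Proof.
move=> fe; apply: leq_trans (degree_del_vertex e v w).
by rewrite leq_add2r; apply: card_colors_at.
Qed.

Lemma covers_extend e v g h : symmetric e -> irreflexive e ->
  covers g (del_vertex e v) -> (forall w, (h w != None) = e v w) ->
  covers (extend g v h) e.
Proof.
move=> eC ei ge hv x y; rewrite /extend; case: (eqVneq x v) => [->|xv] //.
case: (eqVneq y v) => [->|yv]; first by rewrite hv eC.
by rewrite ge /del_vertex xv yv.
Qed.

Lemma colors_at_extend g v h w c : w != v ->
  c \in colors_at (extend g v h) w -> (c \in colors_at g w) || (h w == Some c).
Proof.
move=> wv /colors_atP[t]; rewrite /extend (negbTE wv).
by case: ifP => _; [move/eqP->; rewrite orbT | move/mem_colors_at ->].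
Qed.

Lemma colors_at_extend_center g v h c :
  c \in colors_at (extend g v h) v -> exists w, h w = Some c.
Proof. by case/colors_atP=> w; rewrite /extend eqxx; exists w. Qed.

Lemma notin_colors_at_delete f x w c : acyclic_coloring f ->
  f x w = Some c -> c \notin colors_at (delete f x) w.
Proof.
move=> okf xw; apply/negP => /colors_atP[t wt]; rewrite (colC okf) in xw.
by move: (wt); rewrite (col_inj okf (delete_sub wt) xw) /delete eqxx orbT.
Qed.

Lemma delete_extend_delete_sub f x h s t c :
  delete (extend (delete f x) x h) x s t = Some c -> f s t = Some c.
Proof.
rewrite /delete /extend; case: (eqVneq s x) => //= _; case: (eqVneq t x) => //= _.
Qed.

(** Recolouring the edges at [x] is written as deleting [x] and extending back, so that the
    extension criterion applies to it. *)
Lemma covers_recolor f e x h : (forall s t, f s t = f t s) -> covers f e ->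
  (forall w, (h w != None) = (f x w != None)) ->
  covers (extend (delete f x) x h) e.
Proof.
move=> fC fe hf s t; rewrite /extend /delete; case: (eqVneq s x) => [->|sx].
  by rewrite hf fe.
by case: (eqVneq t x) => [->|tx]; rewrite -fe // hf fC.
Qed.

Variables (D : nat) (e : rel T).
Hypotheses (cardC : #|C| = D + 3) (eC : symmetric e) (ei : irreflexive e).
Hypothesis (degD : forall w, degree e w <= D).

Lemma cardsC_colors (A : {set C}) : #|~: A| = D + 3 - #|A|.
Proof. by rewrite -cardC -(cardsC A) addKn. Qed.

Lemma colorable_extend v g h : acyclic_coloring g -> covers g (del_vertex e v) ->
  (forall w, (h w != None) = e v w) ->
  (forall w w' p, h w = Some p -> h w' = Some p -> w = w') ->
  (forall w p, h w = Some p -> p \notin colors_at g w) ->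
  (forall w w' p q, w != w' -> h w = Some p -> h w' = Some q ->
     ~~ connect (bichrom g p q) w w') ->
  colorable e.
Proof.
move=> okg ge hv hinj hcol hconn; exists (extend g v h).
split; last exact: covers_extend.
apply: acyclic_coloring_extend => // [w|].
  by apply/eqP; have := ge v w; rewrite /del_vertex eqxx /= => /negbFE.
by apply/eqP; have := hv v; rewrite ei => /negbFE.
Qed.

Lemma colorable_deg1 v x : (forall w, e v w = (w == x)) ->
  colorable (del_vertex e v) -> colorable e.
Proof.
move=> Nv [g [okg ge]].
have [|r _ rx] := @exists_in_notin C setT (colors_at g x).
  rewrite cardsT cardC; apply: leq_ltn_trans (card_colors_at x ge) _.
  by have := degree_del_vertex e v x; have := degD x; lia.
apply: (@colorable_extend v g (fun w => if w == x then Some r else None)) => //.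
- by move=> w; rewrite Nv; case: (w =P x).
- by move=> w w' p; do 2 case: eqVneq => // ->.
- by move=> w p; case: eqVneq => // -> [<-].
by move=> w w' p q ww'; do 2 (case: eqVneq => // ?; subst); rewrite eqxx in ww'.
Qed.

(** Both [x] and [y] miss at least four colours. A colour missing at both serves as [p]. Otherwise
    some colour [p] missing at [y] leads from [x] to a neighbour [u] of degree at most three; a
    colour [r] missing at [x] and at [u] then stops the path. *)
Lemma colorable_deg2 v x y : x != y -> (forall w, e v w = (w == x) || (w == y)) ->
  #|[set u | e x u & 3 < degree e u]| <= 3 ->
  colorable (del_vertex e v) -> colorable e.
Proof.
move=> xy Nv high [g [okg ge]].
have cx : #|colors_at g x| < D.
  have := card_colors_at_del x ge; rewrite eC Nv eqxx addn1 => H.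
  exact: leq_trans H (degD x).
have cy : #|colors_at g y| < D.
  have := card_colors_at_del y ge; rewrite eC Nv eqxx orbT addn1 => H.
  exact: leq_trans H (degD y).
suff [p [r [py rx pr ncon]]] : exists p r, [/\ p \notin colors_at g y,
    r \notin colors_at g x, p != r & ~~ connect (bichrom g r p) x y].
  apply: (@colorable_extend v g
    (fun w => if w == x then Some r else if w == y then Some p else None)) => //.
  - by move=> w; rewrite Nv; case: (w =P x) => //; case: (w =P y).
  - move=> w w' c; case: (eqVneq w x) => [->|_]; case: (eqVneq w' x) => [->|_] //.
    + by case: eqVneq => // _ [<-] [rp]; rewrite rp eqxx in pr.
    + by case: eqVneq => // _ [<-] [rp]; rewrite rp eqxx in pr.
    by do 2 case: eqVneq => // ->.
  - by move=> w c; case: eqVneq => [-> [<-]|_] //; case: eqVneq => // -> [<-].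
  move=> w w' c c' ww'; case: (eqVneq w x) => [?|_]; case: (eqVneq w' x) => [?|_]; subst.
  - by rewrite eqxx in ww'.
  - by case: eqVneq => // -> [<-] [<-].
  - by case: eqVneq => // -> [<-] [<-]; rewrite connect_bichromC connect_bichrom_sym //; apply: colC.
  by do 2 (case: eqVneq => // ?; subst); rewrite eqxx in ww'.
have [/exists_inP[p py px]|] := boolP [exists p in ~: colors_at g y, p \notin colors_at g x].
  have [|r] := @exists_in_notin C (~: colors_at g x) [set p].
    by rewrite cardsC_colors cards1; lia.
  rewrite in_setC in_set1 => rx rp; rewrite in_setC in py; exists p, r; split=> //.
    by rewrite eq_sym.
  apply/negP => /(connect_bichrom_ends okg) [] //.
  by move=> pin; rewrite pin in px.
rewrite negb_exists_in => /forall_inP Hsub.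
(* At least four colours are missing at [y], but at most three edges at [x] lead to vertices of
   degree above three. *)
have [|_ /imsetP[p py ->]] := @exists_in_notin _ (Some @: (~: colors_at g y))
   (g x @: [set u | e x u & 3 < degree e u]).
  apply: leq_ltn_trans (leq_imset_card _ _) _; apply: leq_ltn_trans high _.
  by rewrite (card_imset _ (@Some_inj _)) cardsC_colors; lia.
have /colors_atP[u xu] := negbNE (Hsub p py).
move=> ph.
have exu : e x u.
  by have := ge x u; rewrite xu /= => /esym /and3P[].
have du : degree e u <= 3.
  rewrite leqNgt; apply: contra ph => du; apply/imsetP; exists u => //.
  by rewrite inE exu.
have [|r rx ru] := @exists_in_notin C (~: colors_at g x) (colors_at g u).
  rewrite cardsC_colors; have := card_colors_at_del u ge; lia.
rewrite !in_setC in rx py; exists p, r; split=> //.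
  apply: contraNneq ru => <-; apply/colors_atP; exists x; by rewrite (colC okg).
apply/negP => /(connect_bichrom_ends okg) [] // _ _ /(_ u xu) rin.
by rewrite rin in ru.
Qed.

End Graphs.

(** * Vertices of degree three *)

Section Counting.
Variable C : finType.
Implicit Types (E R : {set C}) (c a b q : C).

Lemma card_setI_le_one_out R E a : #|R| <= 3 -> a \in R -> a \notin E -> #|R :&: E| <= 2.
Proof.
move=> R3 aR aE; have : #|[set a]| <= #|R :\: E|.
  by apply: subset_leq_card; rewrite sub1set inE aE.
by rewrite cards1; have := cardsID E R; nat_lia.
Qed.

Lemma card_setI_le_two_out R E a b : #|R| <= 3 -> a != b -> a \in R -> a \notin E ->
  b \in R -> b \notin E -> #|R :&: E| <= 1.
Proof.
move=> R3 ab aR aE bR bE; have : #|[set a; b]| <= #|R :\: E|.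
  by apply: subset_leq_card; rewrite subUset !sub1set !inE aE bE aR.
by rewrite cards2 ab; have := cardsID E R; nat_lia.
Qed.

(** Otherwise [E :\: R1] and [E :\: R2] would be disjoint and both inside [R3 :&: E], so that
    [2 * (#|E| - 2) <= 2], against [3 < #|E|]. *)
Lemma exists_missing_two E R1 R2 R3 : 3 < #|E| ->
  #|R1 :&: E| <= 2 -> #|R2 :&: E| <= 2 -> #|R3 :&: E| <= 2 ->
  exists2 a, a \in E & [|| (a \notin R1) && (a \notin R2),
    (a \notin R1) && (a \notin R3) | (a \notin R2) && (a \notin R3)].
Proof.
move=> E4 h1 h2 h3; apply/exists_inP; apply: contraTT E4.
rewrite negb_exists_in => /forall_inP H; rewrite -leqNgt.
have d12 : #|(E :\: R1) :&: (E :\: R2)| = 0.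
  apply/eqP; rewrite cards_eq0 -subset0; apply/subsetP => a.
  rewrite in_setI !in_setD => /andP[/andP[a1 aE] /andP[a2 _]].
  by have := H a aE; rewrite a1 a2.
have sub : #|(E :\: R1) :|: (E :\: R2)| <= #|R3 :&: E|.
  apply: subset_leq_card; apply/subsetP => a; rewrite in_setU in_setI !in_setD.
  move=> ha; have aE : a \in E by case/orP: ha => /andP[].
  have := H a aE; rewrite aE !andbT in ha *.
  by case/orP: ha => ->; rewrite /= ?negb_or ?negbK => /and3P[] //; case: (a \in R3); rewrite ?orbT ?andbF.
have := cardsU (E :\: R1) (E :\: R2); rewrite d12.
by have := cardsD E R1; have := cardsD E R2; rewrite ![E :&: _]setIC; nat_lia.
Qed.

(* Recolouring [x u1] with [a] closes no bichromatic cycle through [x u2] or [x u3],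
   where [Ri] is the set of colours at [ui] and [ci] the colour of [x ui]. *)
Definition swappable c2 c3 R1 R2 R3 a :=
  [&& a \notin R1, (c2 \in R1) ==> (a \notin R2) & (c3 \in R1) ==> (a \notin R3)].

(** With [c2] and [c3] outside [R1] both implications are vacuous, and [a] has to avoid only [q] and
    at most two colours of [R1 :&: E]. *)
Lemma swappable_isolated E c1 c2 c3 R1 R2 R3 q : 3 < #|E| -> #|R1| <= 3 ->
  c1 \in R1 -> c1 \notin E -> c2 \notin R1 -> c3 \notin R1 ->
  exists a, [/\ a \in E, a != q & swappable c2 c3 R1 R2 R3 a].
Proof.
move=> E4 h1 c1R c1E n2 n3.
have [|a aE] := @exists_in_notin C E (q |: (R1 :&: E)).
  by rewrite cardsU1; have := card_setI_le_one_out h1 c1R c1E; nat_lia.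
rewrite in_setU1 in_setI negb_or aE andbT => /andP[aq aR].
by exists a; rewrite /swappable aR (negbTE n2) (negbTE n3).
Qed.

(** Unless some [Ri] contains neither of the other two colours, each [Ri] contains two colours
    outside [E], hence meets [E] at most once. Then [a] has to avoid [q] and two such intersections,
    at most three colours in all. *)
Lemma exists_swappable E c1 c2 c3 R1 R2 R3 q : 3 < #|E| ->
  #|R1| <= 3 -> #|R2| <= 3 -> #|R3| <= 3 ->
  c1 != c2 -> c1 != c3 -> c2 != c3 ->
  c1 \in R1 -> c2 \in R2 -> c3 \in R3 ->
  c1 \notin E -> c2 \notin E -> c3 \notin E ->
  exists a, [/\ a \in E, a != q & [|| swappable c2 c3 R1 R2 R3 a,
    swappable c3 c1 R2 R3 R1 a | swappable c1 c2 R3 R1 R2 a]].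
Proof.
move=> E4 h1 h2 h3 n12 n13 n23 i1 i2 i3 e1 e2 e3.
have [/norP[a1 a2]|m1] := boolP (~~ ((c2 \in R1) || (c3 \in R1))).
  case: (swappable_isolated (c2 := c2) (c3 := c3) R2 R3 q E4 h1 i1 e1) => // a [aE aq aS].
  by exists a; rewrite aS.
have [/norP[a1 a2]|m2] := boolP (~~ ((c3 \in R2) || (c1 \in R2))).
  case: (swappable_isolated (c2 := c3) (c3 := c1) R3 R1 q E4 h2 i2 e2) => // a [aE aq aS].
  by exists a; rewrite aS orbT.
have [/norP[a1 a2]|m3] := boolP (~~ ((c1 \in R3) || (c2 \in R3))).
  case: (swappable_isolated (c2 := c1) (c3 := c2) R1 R2 q E4 h3 i3 e3) => // a [aE aq aS].
  by exists a; rewrite aS !orbT.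
rewrite !negbK in m1 m2 m3.
have k2 : #|R2 :&: E| <= 1.
  case/orP: m2 => m2; first exact: (card_setI_le_two_out h2 n23 i2 e2 m2 e3).
  by rewrite eq_sym in n12; exact: (card_setI_le_two_out h2 n12 i2 e2 m2 e1).
have k3 : #|R3 :&: E| <= 1.
  case/orP: m3 => m3.
    by rewrite eq_sym in n13; exact: (card_setI_le_two_out h3 n13 i3 e3 m3 e1).
  by rewrite eq_sym in n23; exact: (card_setI_le_two_out h3 n23 i3 e3 m3 e2).
have pick (B : {set C}) : #|B| <= 2 -> exists a, [/\ a \in E, a != q & a \notin B].
  move=> B2; have [|a aE] := @exists_in_notin C E (q |: B); first by rewrite cardsU1; nat_lia.
  by rewrite in_setU1 negb_or => /andP[aq aB]; exists a.
have [c2R|c2R] := boolP (c2 \in R1); have [c3R|c3R] := boolP (c3 \in R1).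
- have [|a [aE aq]] := pick ((R2 :&: E) :|: (R3 :&: E)).
    by apply: leq_trans (leq_card_setU _ _) _; nat_lia.
  rewrite in_setU !in_setI negb_or aE !andbT => /andP[a2 a3].
  exists a; split=> //; rewrite /swappable a2 a3 !implybT !andbT.
  (* The colours [c1], [c2], [c3] fill [R1], which is therefore disjoint from [E]. *)
  have -> : a \notin R1 => //.
  have : [set c1; c2; c3] \subset R1.
    by apply/subsetP => c; rewrite !inE -orbA => /or3P[]/eqP ->.
  move=> sub; have <- : [set c1; c2; c3] = R1.
    apply/eqP; rewrite eqEcard sub -setUA cardsU1 cards2 !inE negb_or n12 n13 n23.
    exact: h1.
  rewrite !inE; apply: contraL aE => /orP[/orP[]|] /eqP -> //.
- have [|a [aE aq]] := pick ((R1 :&: E) :|: (R2 :&: E)).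
    apply: leq_trans (leq_card_setU _ _) _.
    by have := card_setI_le_two_out h1 n12 i1 e1 c2R e2; nat_lia.
  rewrite in_setU !in_setI negb_or aE !andbT => /andP[a1 a2].
  by exists a; rewrite /swappable a1 a2 (negbTE c3R) implybT.
- have [|a [aE aq]] := pick ((R1 :&: E) :|: (R3 :&: E)).
    apply: leq_trans (leq_card_setU _ _) _.
    by have := card_setI_le_two_out h1 n13 i1 e1 c3R e3; nat_lia.
  rewrite in_setU !in_setI negb_or aE !andbT => /andP[a1 a3].
  by exists a; rewrite /swappable a1 a3 (negbTE c2R) implybT.
by move: m1; rewrite (negbTE c2R) (negbTE c3R).
Qed.

End Counting.

(** * A cubic vertex with a neighbour of degree three or four *)

Section Cubic.
Variables (T C : finType) (D : nat) (e : rel T).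
Hypotheses (cardC : #|C| = D + 3) (eC : symmetric e) (ei : irreflexive e).
Hypothesis (degD : forall w, degree e w <= D).
Implicit Types (f g : T -> T -> option C) (a b c p q r : C) (x y z u v w : T).

(* The edges [vy] and [vz] can receive the colours [p] and [q], [v] being isolated
   in [g]. *)
Definition attachable g y z p q :=
  [&& p != q, p \notin colors_at g y, q \notin colors_at g z &
      ~~ connect (bichrom g p q) y z].

Record cubic v x y z : Prop := Cubic {
  cub_nbr : forall w, e v w = [|| w == x, w == y | w == z];
  cub_xy : x != y; cub_xz : x != z; cub_yz : y != z }.

Lemma cubic_swap v x y z : cubic v x y z -> cubic v x z y.
Proof.
case=> Nv xy xz yz; split=> //; last by rewrite eq_sym.
by move=> w; rewrite Nv; congr orb; apply: orbC.
Qed.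

Lemma attachable_swap g y z p q : (forall s t, g s t = g t s) ->
  attachable g y z p q = attachable g z y q p.
Proof.
move=> gC; rewrite /attachable connect_bichromC connect_bichrom_sym // eq_sym.
by congr andb; rewrite !andbA; congr andb; apply: andbC.
Qed.

Variable v : T.

Definition partial_coloring g := acyclic_coloring g /\ covers g (del_vertex e v).

Section OneVertex.
Variables (x y z : T).
Hypothesis (cub : cubic v x y z).

Let xy : x != y := cub_xy cub.
Let xz : x != z := cub_xz cub.
Let yz : y != z := cub_yz cub.

Lemma card_colors_nbr g w : covers g (del_vertex e v) -> e v w ->
  #|colors_at g w| < degree e w.
Proof. by move=> ge vw; have := card_colors_at_del w ge; rewrite eC vw addn1. Qed.

Lemma card_colors_y g : partial_coloring g -> #|colors_at g y| < D.
Proof.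
move=> [_ ge]; apply: leq_trans (degD y); apply: card_colors_nbr => //.
by rewrite (cub_nbr cub) eqxx orbT.
Qed.

Lemma card_colors_le g w : partial_coloring g -> #|colors_at g w| <= D.
Proof.
by move=> [_ ge]; apply: leq_trans (degD w); have := card_colors_at_del w ge; nat_lia.
Qed.

(** [attachable] settles the pair [y], [z], so only the two paths from [x] remain to be excluded. *)
Lemma colorable_cubic g p q r : partial_coloring g -> attachable g y z p q ->
  r \notin colors_at g x -> r != p -> r != q ->
  ~~ connect (bichrom g r p) x y -> ~~ connect (bichrom g r q) x z ->
  colorable C e.
Proof.
move=> [okg ge] /and4P[pq py qz cpq] rx rp rq crp crq; have gC := colC okg.
pose h w := if w == x then Some r else if w == y then Some p else
            if w == z then Some q else None.
have hP w c : h w = Some c -> [\/ w = x /\ c = r, w = y /\ c = p | w = z /\ c = q].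
  rewrite /h; case: eqP => [-> [<-]|_]; first by constructor 1.
  case: eqP => [-> [<-]|_]; first by constructor 2.
  by case: eqP => // -> [<-]; constructor 3.
apply: (@colorable_extend _ C e eC ei v g h) => //.
- move=> w; rewrite (cub_nbr cub) /h; case: (w =P x) => //; case: (w =P y) => //.
  by case: (w =P z).
- move=> w w' c /hP[][-> ->] /hP[][-> E] //.
  + by rewrite E eqxx in rp.
  + by rewrite E eqxx in rq.
  + by rewrite E eqxx in rp.
  + by rewrite E eqxx in pq.
  + by rewrite E eqxx in rq.
  + by rewrite E eqxx in pq.
- by move=> w c /hP[][-> ->].
move=> w w' c c' ww' /hP[][E1 ->] /hP[][E2 ->]; move: ww';
  rewrite E1 E2 ?eqxx // => _; rewrite connect_bichromC connect_bichrom_sym //.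
Qed.

(** With [q] and [r] both missing at [x], no path in these colours leaves [x]; the only possible
    obstacle is the path towards [y]. *)
Lemma attached_x_connect g p q r : partial_coloring g -> attachable g y z p q ->
  q \notin colors_at g x -> r \notin colors_at g x -> r != p -> r != q ->
  connect (bichrom g r p) x y \/ colorable C e.
Proof.
move=> okg att qx rx rp rq; have [|ncon] := boolP (connect _ x y); [by left|right].
apply: (colorable_cubic okg att rx rp rq ncon _); case: okg => okg _.
case/and4P: att => _ _ qz _; apply/negP => /(connect_bichrom_ends okg) [] //.
by move=> H; rewrite H in qx.
Qed.

Lemma colorable_disjoint g p q : partial_coloring g -> attachable g y z p q ->
  p \notin colors_at g x -> q \notin colors_at g x -> #|colors_at g x| <= D ->
  colorable C e.
Proof.
move=> okg att px qx cx.
have [|r _] := @exists_in_notin C setT (p |: (q |: colors_at g x)).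
  by rewrite cardsT cardC !cardsU1; nat_lia.
rewrite !in_setU1 !negb_or => /and3P[rp rq rx].
case: (attached_x_connect okg att qx rx rp rq) => // con.
case: okg => okg _; case/and4P: att => _ py _ _.
case: (connect_bichrom_ends okg con rx py xy) => H _ _.
by rewrite H in px.
Qed.

(** As [c] is missing at [y], giving [c] to [vx] can fail only by a path in [c] and [q] from [x] to
    [z]. Such a path has its two ends there, so it misses [y], and [c] may replace [p] at [vy]. The
    new colour of [vy] is missing at [x]. *)
Lemma attachable_or_colorable g p q c : partial_coloring g -> attachable g y z p q ->
  p \in colors_at g x -> q \in colors_at g x ->
  c \notin colors_at g x -> c \notin colors_at g y ->
  attachable g y z c q \/ colorable C e.
Proof.
move=> okg att px qx cx cy; have [okg' _] := okg.
have [pq py qz _] := and4P att.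
have cp : c != p by apply: contraNneq cx => ->.
have cq : c != q by apply: contraNneq cx => ->.
have [con|ncon] := boolP (connect (bichrom g c q) x z); last first.
  right; apply: (colorable_cubic okg att cx cp cq _ ncon).
  apply/negP => /(connect_bichrom_ends okg') [] //.
  by move=> _ H; rewrite H in cy.
left; rewrite /attachable cq cy qz connect_bichrom_sym //=; last exact: colC.
rewrite connect_bichrom_sym in con; last exact: colC.
apply: (bichrom_three_ends okg' _ _ _ _ _ _ con); rewrite ?negb_and ?cx ?cy ?qz ?orbT //.
- by rewrite eq_sym.
- by rewrite eq_sym.
Qed.

(* The colour of [vy] occurs at [x], that of [vz] does not.  If every colour is
   blocked at [vx], the neighbourhoods are so rigid that two colours at [x] can be
   exchanged, which reroutes the blocking bichromatic path. *)
Lemma colorable_quartic_one g p q : partial_coloring g -> attachable g y z p q ->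
  #|colors_at g x| <= 3 -> 2 < D ->
  p \in colors_at g x -> q \notin colors_at g x -> colorable C e.
Proof.
move=> okg att cx D3 px qx; have [okg' ge] := okg; have gC := colC okg'.
have [pq py qz _] := and4P att.
(* The candidates for [vx]; they differ from [p], which occurs at [x]. *)
pose A := ~: (q |: colors_at g x).
have AP c : c \in A -> c != q /\ c \notin colors_at g x.
  by rewrite in_setC in_setU1 negb_or => /andP[].
have AF c : c \in colors_at g x -> c \notin A.
  by move=> cin; rewrite in_setC negbK in_setU1 cin orbT.
have Aq : q \notin A by rewrite in_setC negbK in_setU1 eqxx.
have cA : #|A| = D + 2 - #|colors_at g x|.
  by rewrite (cardsC_colors cardC) cardsU1 qx; nat_lia.
have blocked p' : attachable g y z p' q -> p' \in colors_at g x ->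
    (forall c, c \in A -> connect (bichrom g c p') x y) \/ colorable C e.
  move=> att' px'; apply: (@forall_or C) => c /[dup] cA' /AP[cq cx'].
  apply: (attached_x_connect okg att') => //.
  by apply: contraNneq cx' => ->.
case: (blocked p att px) => // con.
(* All of [A] is blocked and so occurs at [y]; it has at least [D - 1] elements, and [y] has no room
   for more. *)
have Ey : colors_at g y = A.
  apply/esym/eqP; rewrite eqEcard; apply/andP; split.
    apply/subsetP => c cinA; have [_ cnx] := AP c cinA.
    by case: (connect_bichrom_ends okg' (con c cinA) cnx py xy).
  by have := card_colors_y okg; nat_lia.
(* The sizes of [A] and of the colours at [y] leave room for a second colour at [x], which can
   replace [p] at [vy]. *)
have [|p2 p2x] := @exists_in_notin C (colors_at g x) [set p].
  by rewrite cards1; have := card_colors_y okg; rewrite Ey cA; nat_lia.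
rewrite in_set1 => p2p.
have p2y : p2 \notin colors_at g y by rewrite Ey AF.
have p2q : p2 != q by apply: contraTneq p2x => ->.
have att2 : attachable g y z p2 q.
  rewrite /attachable p2q p2y qz /=; apply: notin_bichrom_isolated => //.
  by rewrite Ey.
case: (blocked p2 att2 p2x) => // con2.
(* Each blocking path puts its colour at the [p']-neighbour of [x]; with [p'] these already make [D]
   colours. *)
have Eu p' u : p' \in colors_at g x -> p' \notin colors_at g y ->
    (forall c, c \in A -> connect (bichrom g c p') x y) ->
    g x u = Some p' -> colors_at g u = p' |: A.
  move=> px' py' con' xu; apply/esym/eqP; rewrite eqEcard; apply/andP; split.
    apply/subsetP => c; rewrite in_setU1 => /predU1P[->|cinA].
      by apply/colors_atP; exists x; rewrite gC.
    have [_ cnx] := AP c cinA.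
    by case: (connect_bichrom_ends okg' (con' c cinA) cnx py' xy) => _ _; apply.
  rewrite cardsU1 (AF _ px') cA; have := card_colors_le u okg; nat_lia.
have /colors_atP[u1 xu1] := px; have /colors_atP[u2 xu2] := p2x.
have Eu1 := Eu _ _ px py con xu1; have Eu2 := Eu _ _ p2x p2y con2 xu2.
have u12 : u1 != u2.
  by apply: contraNneq p2p => E; move: xu1; rewrite E xu2 => -[->].
have yu1 : y != u1.
  by apply: contraNneq py => ->; rewrite Eu1 in_setU1 eqxx.
have yu2 : y != u2.
  by apply: contraNneq p2y => ->; rewrite Eu2 in_setU1 eqxx.
have gxx : g x x = None.
  by apply/eqP/negbNE; rewrite ge /del_vertex ei !andbF.
have xu2n : x != u2 by apply: contra_eqN xu2 => /eqP <-; rewrite gxx.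
have xu1n : x != u1 by apply: contra_eqN xu1 => /eqP <-; rewrite gxx.
(* Exchange the colours of [xu1] and [xu2]. *)
pose h w := if w == u1 then Some p2 else if w == u2 then Some p else g x w.
have hx w c : h w = Some c -> c \in colors_at g x.
  rewrite /h; case: eqP => [_ [<-] //|_]; case: eqP => [_ [<-] //|_].
  exact: mem_colors_at.
have hold w c : w != u1 -> w != u2 -> h w = Some c -> g x w = Some c.
  by rewrite /h => /negbTE -> /negbTE ->.
have hu1 : h u1 = Some p2 by rewrite /h eqxx.
have hu2 : h u2 = Some p by rewrite /h eq_sym (negbTE u12) eqxx.
have delA w : (w == u1) || (w == u2) -> colors_at (delete g x) w \subset A.
  move=> wu; apply/subsetP => c cin; have cin' := subsetP (colors_at_delete_sub _ _ _) _ cin.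
  case/orP: wu => /eqP E; subst w; move: cin'; rewrite ?Eu1 ?Eu2 in_setU1 => /predU1P[E|//].
  - by subst c; rewrite (negbTE (notin_colors_at_delete okg' xu1)) in cin.
  - by subst c; rewrite (negbTE (notin_colors_at_delete okg' xu2)) in cin.
have deln w c : (w == u1) || (w == u2) -> c \in colors_at g x ->
    c \notin colors_at (delete g x) w.
  by move=> wu cinx; apply: contra (AF _ cinx) => /(subsetP (delA _ wu)).
(* Without [x], the vertices [u1] and [u2] see only colours of [A], so they are isolated with
   respect to the colours at [x]. *)
have iso w w' c c' : (w == u1) || (w == u2) -> w != w' -> h w = Some c ->
    h w' = Some c' -> ~~ connect (bichrom (delete g x) c c') w w'.
  move=> wu ww' /hx hc /hx hc'; apply: notin_bichrom_isolated => //; exact: deln.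
pose g' := extend (delete g x) x h.
have okd := acyclic_coloring_delete x okg'.
have okg1 : partial_coloring g'.
  split; last first.
    apply: covers_recolor => // w; rewrite /h.
    case: (w =P u1) => [->|_]; first by rewrite xu1.
    by case: (w =P u2) => [->|//]; rewrite xu2.
  apply: acyclic_coloring_extend => //.
  - by move=> w; rewrite /delete eqxx.
  - by rewrite /h (negbTE xu1n) (negbTE xu2n).
  - have inj1 w c : w != u1 -> w != u2 -> h w = Some c -> c != p /\ c != p2.
      move=> w1 w2 /(hold _ _ w1 w2) xw; split.
        by apply: contraNneq w1 => E; subst c; rewrite (col_inj okg' xw xu1).
      by apply: contraNneq w2 => E; subst c; rewrite (col_inj okg' xw xu2).
    move=> w w' c.
    case: (eqVneq w u1) => [->|w1]; [|case: (eqVneq w u2) => [->|w2]];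
    (case: (eqVneq w' u1) => [->|w1']; [|case: (eqVneq w' u2) => [->|w2']]) => //;
      rewrite ?hu1 ?hu2.
    + by move=> [<-] [E]; rewrite E eqxx in p2p.
    + by move=> [<-] /(inj1 _ _ w1' w2') []; rewrite eqxx.
    + by move=> [<-] [E]; rewrite E eqxx in p2p.
    + by move=> [<-] /(inj1 _ _ w1' w2') []; rewrite eqxx.
    + by move=> /(inj1 _ _ w1 w2) [] _ + [E]; rewrite E eqxx.
    + by move=> /(inj1 _ _ w1 w2) [] + _ [E]; rewrite E eqxx.
    by move=> /(hold _ _ w1 w2) H /(hold _ _ w1' w2'); apply: (col_inj okg' H).
  - move=> w c hw; have [wu|] := boolP ((w == u1) || (w == u2)).
      exact: (deln _ _ wu (hx _ _ hw)).
    rewrite negb_or => /andP[w1 w2]; apply: (notin_colors_at_delete okg').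
    exact: hold hw.
  move=> w w' c c' ww' hw hw'.
  have [wu|] := boolP ((w == u1) || (w == u2)); first exact: (iso _ _ _ _ wu ww' hw hw').
  rewrite negb_or => /andP[w1 w2].
  have [wu'|] := boolP ((w' == u1) || (w' == u2)).
    rewrite connect_bichromC connect_bichrom_sym; last exact: colC okd.
    by apply: (iso _ _ _ _ wu' _ hw' hw); rewrite eq_sym.
  rewrite negb_or => /andP[w1' w2'].
  apply: (connect_delete_forbidden okg' (hold _ _ w1 w2 hw) (hold _ _ w1' w2' hw') ww').
  by apply/eqP => wx; move: hw; rewrite wx /h (negbTE xu1n) (negbTE xu2n) gxx.
have yx : y != x by rewrite eq_sym.
have py' : p \notin colors_at g' y.
  apply/negP => /(colors_at_extend yx) /orP[/(subsetP (colors_at_delete_sub _ _ _))|].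
    by rewrite (negbTE py).
  by move=> /eqP /(hold _ _ yu1 yu2); rewrite gC => /mem_colors_at; rewrite (negbTE py).
have qy' : q \notin colors_at g' y.
  apply/negP => /(colors_at_extend yx) /orP[/(subsetP (colors_at_delete_sub _ _ _))|].
    by rewrite Ey (negbTE Aq).
  by move=> /eqP /hx; rewrite (negbTE qx).
have att' : attachable g' y z p q.
  rewrite /attachable pq py' notin_bichrom_isolated // andbT.
  have zx : z != x by rewrite eq_sym.
  apply/negP => /(colors_at_extend zx) /orP[/(subsetP (colors_at_delete_sub _ _ _))|].
    by rewrite (negbTE qz).
  by move=> /eqP /hx; rewrite (negbTE qx).
have g'x c : c \in colors_at g' x -> c \in colors_at g x.
  by case/colors_at_extend_center => w /hx.
have [|a aA _] := @exists_in_notin C A set0; first by rewrite cards0; nat_lia.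
have [aq ax] := AP a aA.
have ap : a != p by apply: contraNneq ax => ->.
case: (@attached_x_connect g' p q a) => //.
- by apply: contra qx => /g'x.
- by apply: contra ax => /g'x.
move=> con'.
(* In [g'] the [p]-edge at [x] leads to [u2], so the new blocking path gives one in [g] from [u2] to
   [y]. But in [g] the path from [y] ends at [x], and [u2], lacking [p], would be a third end. *)
have /(connect_sub_bichrom (@delete_extend_delete_sub T C g x h)) con2y :
    connect (bichrom (delete g' x) a p) u2 y.
  apply: (connect_bichrom_leaf _ con' _ _ xy); first by case: okg1.
    by apply: contra ax => /g'x.
  by rewrite /g' /extend eqxx.
have := con a aA; rewrite connect_bichrom_sym // => conyx.
rewrite connect_bichrom_sym // in con2y.
suff : ~~ connect (bichrom g a p) y u2 by rewrite con2y.
apply: (bichrom_three_ends okg' _ _ _ _ _ _ conyx) => //; rewrite negb_and.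
- by rewrite py orbT.
- by rewrite ax.
by rewrite Eu2 !in_setU1 [p == p2]eq_sym (negbTE p2p) (negbTE (AF _ px)) orbT.
Qed.

End OneVertex.

(** If [p] and [q] both occur at [x], the at most [D + 2] colours at [x] and [y] leave one missing
    at both, which colours [vx] or replaces [p]; then only one of the two attached colours occurs at
    [x]. *)
Lemma colorable_quartic x y z g p q : cubic v x y z -> partial_coloring g ->
  attachable g y z p q -> #|colors_at g x| <= 3 -> 2 < D -> colorable C e.
Proof.
move=> cub okg att cx D3; have cub' := cubic_swap cub; have gC := colC (proj1 okg).
have att' : attachable g z y q p by rewrite -attachable_swap.
have [px|px] := boolP (p \in colors_at g x); have [qx|qx] := boolP (q \in colors_at g x).
- have [|c _] := @exists_in_notin C setT (colors_at g x :|: colors_at g y).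
    rewrite cardsT cardC; apply: leq_ltn_trans (leq_card_setU _ _) _.
    by have := card_colors_y cub okg; nat_lia.
  rewrite in_setU negb_or => /andP[cx' cy].
  case: (attachable_or_colorable cub okg att px qx cx' cy) => // att2.
  rewrite attachable_swap // in att2.
  exact: (colorable_quartic_one cub' okg att2).
- exact: (colorable_quartic_one cub okg att).
- exact: (colorable_quartic_one cub' okg att').
apply: (colorable_disjoint cub okg att) => //.
exact: leq_trans cx _.
Qed.

(** * A cubic vertex with a neighbour of degree five *)

Section Fan.
Variables (x y z : T).
Hypothesis (cub : cubic v x y z).

Let xy : x != y := cub_xy cub.
Let xz : x != z := cub_xz cub.
Let yz : y != z := cub_yz cub.

(* In [G - v] the vertex [x] has the four neighbours [u1], [u2], [u3], [w]; nothing is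
   known about [w]. *)
Record fan g u1 u2 u3 w c1 c2 c3 c4 : Prop := Fan {
  fan1 : g x u1 = Some c1; fan2 : g x u2 = Some c2;
  fan3 : g x u3 = Some c3; fan4 : g x w = Some c4;
  fan_uniq : uniq [:: u1; u2; u3; w];
  fan_all : forall t c, g x t = Some c -> t \in [:: u1; u2; u3; w];
  fan_low1 : #|colors_at g u1| <= 3;
  fan_low2 : #|colors_at g u2| <= 3;
  fan_low3 : #|colors_at g u3| <= 3 }.

(** The cyclic symmetry of the low neighbours matches the three alternatives of
    [exists_swappable]. *)
Lemma fan_rot g u1 u2 u3 w c1 c2 c3 c4 :
  fan g u1 u2 u3 w c1 c2 c3 c4 -> fan g u2 u3 u1 w c2 c3 c1 c4.
Proof.
case=> f1 f2 f3 f4 fu fall l1 l2 l3; split=> //.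
  rewrite (perm_uniq (s2 := [:: u1; u2; u3; w])) //.
  by rewrite (perm_catCA [:: u2; u3] [:: u1] [:: w]).
move=> t c /fall; rewrite !inE => /or4P[]->; rewrite ?orbT //.
Qed.

Lemma fan_uniq_colors g u1 u2 u3 w c1 c2 c3 c4 : acyclic_coloring g ->
  fan g u1 u2 u3 w c1 c2 c3 c4 -> uniq [:: c1; c2; c3; c4].
Proof.
move=> okg [f1 f2 f3 f4 fu _ _ _ _].
have ne s t c c' : g x s = Some c -> g x t = Some c' -> s != t -> c != c'.
  move=> fs ft; apply: contraNneq => E; rewrite E in fs.
  by rewrite (col_inj okg fs ft).
move: fu; rewrite /= !inE !negb_or !andbT.
move=> /andP[/and3P[n12 n13 n14] /andP[/andP[n23 n24] n34]].
by rewrite (ne _ _ _ _ f1 f2) // (ne _ _ _ _ f1 f3) // (ne _ _ _ _ f1 f4) //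
  (ne _ _ _ _ f2 f3) // (ne _ _ _ _ f2 f4) // (ne _ _ _ _ f3 f4).
Qed.

Lemma fan_colors g u1 u2 u3 w c1 c2 c3 c4 c :
  fan g u1 u2 u3 w c1 c2 c3 c4 -> (c \in colors_at g x) = (c \in [:: c1; c2; c3; c4]).
Proof.
move=> [f1 f2 f3 f4 _ fall _ _ _]; apply/idP/idP.
  case/colors_atP=> t xt; have := fall _ _ xt; rewrite !inE => /or4P[]/eqP E;
    move: xt; rewrite E ?f1 ?f2 ?f3 ?f4 => -[->]; by rewrite eqxx ?orbT.
rewrite !in_cons in_nil orbF => /or4P[]/eqP ->.
- exact: mem_colors_at f1.
- exact: mem_colors_at f2.
- exact: mem_colors_at f3.
exact: mem_colors_at f4.
Qed.

Lemma fan_card g u1 u2 u3 w c1 c2 c3 c4 : acyclic_coloring g ->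
  fan g u1 u2 u3 w c1 c2 c3 c4 -> #|colors_at g x| = 4.
Proof.
move=> okg fn; have /card_uniqP := fan_uniq_colors okg fn => /= <-.
by apply: eq_card => c; rewrite (fan_colors _ fn).
Qed.

(* The colour [c1] moves from [u1] to [w], which frees [c4] at [x]. *)
Lemma colorable_fan_shift g u1 u2 u3 w c1 c2 c3 c4 q a : partial_coloring g ->
  fan g u1 u2 u3 w c1 c2 c3 c4 -> attachable g y z c4 q -> q \notin colors_at g x ->
  colors_at g w = c4 |: ~: colors_at g x ->
  a \notin colors_at g x -> a != q ->
  swappable c2 c3 (colors_at g u1) (colors_at g u2) (colors_at g u3) a ->
  colorable C e.
Proof.
move=> okg fn att qx Ew ax aq /and3P[au1 /implyP au2 /implyP au3].
have [okg' ge] := okg; have gC := colC okg'.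
have okd := acyclic_coloring_delete x okg'.
have inx c := fan_colors c fn.
have := fan_uniq_colors okg' fn; have [f1 f2 f3 f4 fu fall _ _ _] := fn.
rewrite /= !inE !negb_or !andbT.
move=> /andP[/and3P[n12 n13 n14] /andP[/andP[n23 n24] n34]].
move: fu; rewrite /= !inE !negb_or !andbT.
move=> /andP[/and3P[m12 m13 m14] /andP[/andP[m23 m24] m34]].
move: (ax); rewrite inx !inE !negb_or => /and4P[a1 a2 a3 a4].
move: (qx); rewrite inx !inE !negb_or => /and4P[q1 q2 q3 q4].
have [pq py qz npq] := and4P att.
have gxx : g x x = None.
  by apply/eqP/negbNE; rewrite ge /del_vertex ei !andbF.
have nx t c : g x t = Some c -> t != x.
  by move=> xt; apply/eqP => E; move: xt; rewrite E gxx.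
pose h t := if t == w then Some c1 else if t == u1 then Some a else g x t.
have hP t c : h t = Some c ->
    [\/ t = w /\ c = c1, t = u1 /\ c = a, t = u2 /\ c = c2 | t = u3 /\ c = c3].
  rewrite /h; case: eqP => [-> [<-]|tw]; first by constructor 1.
  case: eqP => [-> [<-]|t1]; first by constructor 2.
  move=> xt; have := fall _ _ xt; rewrite !inE => /or4P[]/eqP E //; subst t.
  - by rewrite f2 in xt; case: xt => <-; constructor 3.
  - by rewrite f3 in xt; case: xt => <-; constructor 4.
(* Apart from [c4], the vertex [w] sees only colours missing at [x]; hence it can receive [c1] and
   is isolated in the colours [c1], [c2], [c3]. *)
have delw c : c \in [:: c1; c2; c3] -> c \notin colors_at (delete g x) w.
  move=> cin; apply/negP => /(subsetP (colors_at_delete_sub _ _ _)).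
  rewrite Ew in_setU1 in_setC inx; move: cin.
  by rewrite !inE => /or3P[]/eqP ->; rewrite ?eqxx ?orbT //= ?(negbTE n14) ?(negbTE n24) ?(negbTE n34).
have delu1 : a \notin colors_at (delete g x) u1.
  by apply: contra au1; apply: (subsetP (colors_at_delete_sub _ _ _)).
have del2 := notin_colors_at_delete okg' f2.
have del3 := notin_colors_at_delete okg' f3.
have con_sym s t c c' : ~~ connect (bichrom (delete g x) c c') s t ->
    ~~ connect (bichrom (delete g x) c' c) t s.
  by rewrite connect_bichromC connect_bichrom_sym //; apply: colC okd.
have conw t c : w != t -> c \in [:: c2; c3] -> ~~ connect (bichrom (delete g x) c1 c) w t.
  move=> wt cin; apply: notin_bichrom_isolated => //; apply: delw; rewrite inE ?eqxx //.
  by rewrite cin orbT.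
have con1w : ~~ connect (bichrom (delete g x) a c1) u1 w.
  by apply: notin_bichrom_isolated => //; apply: notin_colors_at_delete.
(* Such a path would require [c2] at [u1] and [a] at [u2], which [swappable] excludes. *)
have con12 : ~~ connect (bichrom (delete g x) a c2) u1 u2.
  apply/negP => /(connect_bichrom_ends okd) [] // c2in ain _.
  have /negP[] := au2 (subsetP (colors_at_delete_sub _ _ _) _ c2in).
  exact: (subsetP (colors_at_delete_sub _ _ _) _ ain).
have con13 : ~~ connect (bichrom (delete g x) a c3) u1 u3.
  apply/negP => /(connect_bichrom_ends okd) [] // c3in ain _.
  have /negP[] := au3 (subsetP (colors_at_delete_sub _ _ _) _ c3in).
  exact: (subsetP (colors_at_delete_sub _ _ _) _ ain).
have con23 : ~~ connect (bichrom (delete g x) c2 c3) u2 u3.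
  exact: (connect_delete_forbidden okg' f2 f3 m23 (nx _ _ f2)).
pose g' := extend (delete g x) x h.
have okg1 : partial_coloring g'.
  split; last first.
    apply: covers_recolor => // t; rewrite /h.
    case: (t =P w) => [->|_]; first by rewrite f4.
    by case: (t =P u1) => [->|//]; rewrite f1.
  apply: acyclic_coloring_extend => //.
  - by move=> t; rewrite /delete eqxx.
  - rewrite /h; case: (x =P w) => [E|_]; first by have := nx _ _ f4; rewrite E eqxx.
    by case: (x =P u1) => [E|_] //; have := nx _ _ f1; rewrite E eqxx.
  - move=> s t c /hP[][-> ->] /hP[][-> E] //; exfalso; move/eqP: E; apply/negP => //;
    by rewrite eq_sym.
  - by move=> t c /hP[][-> ->] //; apply: delw; rewrite inE eqxx.
  move=> s t c c' st /hP[][Es ->] /hP[][Et ->]; subst s t; rewrite ?eqxx // in st *;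
    first [exact: conw | exact: con_sym | idtac].
  - by apply: conw; rewrite ?inE ?eqxx.
  - by apply: conw; rewrite ?inE ?eqxx ?orbT.
  - by apply: con_sym; apply: conw; rewrite ?inE ?eqxx // eq_sym.
  - by apply: con_sym; apply: conw; rewrite ?inE ?eqxx ?orbT // eq_sym.
have c4x : c4 \notin colors_at g' x.
  apply/negP => /colors_at_extend_center[t /hP[][_ E]].
  - by rewrite E eqxx in n14.
  - by rewrite E eqxx in a4.
  - by rewrite E eqxx in n24.
  - by rewrite E eqxx in n34.
have qx' : q \notin colors_at g' x.
  apply/negP => /colors_at_extend_center[t /hP[][_ E]].
  - by rewrite E eqxx in q1.
  - by rewrite E eqxx in aq.
  - by rewrite E eqxx in q2.
  - by rewrite E eqxx in q3.
have yx : y != x by rewrite eq_sym.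
have zx : z != x by rewrite eq_sym.
(* Both [c4] and [q] are now missing at [x]. No edge gained either colour, so they remain
   attachable. *)
apply: (colorable_disjoint cub okg1 (p := c4) (q := q)) => //; last exact: card_colors_le.
have sub s c : s != x -> (c == c4) || (c == q) -> c \in colors_at g' s -> c \in colors_at g s.
  move=> sx cc /(colors_at_extend sx) /orP[|/eqP hs].
    exact: (subsetP (colors_at_delete_sub _ _ _)).
  have : c \in colors_at g' x by apply/colors_atP; exists s; rewrite /g' /extend eqxx.
  by case/orP: cc => /eqP ->; rewrite ?(negbTE c4x) ?(negbTE qx').
apply/and4P; split=> //.
- by apply: contra py; apply: sub; rewrite ?eqxx.
- by apply: contra qz; apply: sub; rewrite ?eqxx ?orbT.
apply: contra npq; apply: connect_sub => s t; rewrite /bichrom => st.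
apply: connect1; move: st; rewrite /bichrom /g' {1 2}/extend.
have hn t' : (h t' == Some c4) || (h t' == Some q) = false.
  apply/negP => /orP[]/eqP ht.
    by case/negP: c4x; apply/colors_atP; exists t'; rewrite /g' /extend eqxx.
  by case/negP: qx'; apply/colors_atP; exists t'; rewrite /g' /extend eqxx.
case: (s =P x) => [_|/eqP sx]; first by rewrite hn.
case: (t =P x) => [_|/eqP tx]; first by rewrite hn.
by rewrite /delete (negbTE sx) (negbTE tx).
Qed.

(** Besides [p], the vertex [u] sees at most two colours, while [D - 2], at least three, are
    candidates for [vx]. One of them is missing at [u] and so not blocked. *)
Lemma colorable_low g p q u : partial_coloring g -> attachable g y z p q ->
  #|colors_at g x| = 4 -> 4 < D -> q \notin colors_at g x ->
  g x u = Some p -> #|colors_at g u| <= 3 -> colorable C e.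
Proof.
move=> okg att cx D5 qx xu lu; have [okg' _] := okg.
have pu : p \in colors_at g u by apply/colors_atP; exists x; rewrite (colC okg').
have [|r] := @exists_in_notin C (~: (q |: colors_at g x)) (colors_at g u :\ p).
  rewrite (cardsC_colors cardC) cardsU1 qx cx.
  by have := cardsD1 p (colors_at g u); rewrite pu; nat_lia.
rewrite in_setC in_setU1 negb_or => /andP[rq rx].
have rp : r != p by apply: contraNneq rx => ->; apply: mem_colors_at xu.
rewrite in_setD1 rp /= => ru.
case: (attached_x_connect cub okg att qx rx rp rq) => // con.
have [_ py _ _] := and4P att.
case: (connect_bichrom_ends okg' con rx py xy) => _ _ /(_ u xu).
by rewrite (negbTE ru).
Qed.

(** If [vy] can take [c1] or [c2], a low neighbour finishes. Otherwise counting determines the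
    colours at [y], and a new colour for [vz] releases [q]. If [q] is blocked at [vx] too, [w] sees
    [c4] and exactly the colours missing at [x], and a shift is possible. *)
Lemma colorable_fan_hub g u1 u2 u3 w c1 c2 c3 c4 q : partial_coloring g ->
  fan g u1 u2 u3 w c1 c2 c3 c4 -> attachable g y z c4 q -> q \notin colors_at g x ->
  4 < D -> colorable C e.
Proof.
move=> okg fn att qx D5; have [okg' ge] := okg; have gC := colC okg'.
have inx c := fan_colors c fn; have cx := fan_card okg' fn.
have := fan_uniq_colors okg' fn; have [f1 f2 f3 f4 _ _ l1 l2 l3] := fn.
rewrite /= !inE !negb_or !andbT.
move=> /andP[/and3P[n12 n13 n14] /andP[/andP[n23 n24] n34]].
have [pq py qz npq] := and4P att.
have c1x := mem_colors_at f1; have c2x := mem_colors_at f2.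
have c3x := mem_colors_at f3; have c4x := mem_colors_at f4.
have [att1|natt1] := boolP (attachable g y z c1 q).
  exact: (colorable_low okg att1 cx D5 qx f1).
have [att2|natt2] := boolP (attachable g y z c2 q).
  exact: (colorable_low okg att2 cx D5 qx f2).
have neq c : c \in colors_at g x -> c != q by move=> cin; apply: contraTneq cin => ->.
have nattP c : c \in colors_at g x -> ~~ attachable g y z c q -> c \notin colors_at g y ->
    q \in colors_at g y /\ c \in colors_at g z.
  move=> cin; rewrite /attachable neq // qz => nc cy; move: nc; rewrite cy /= negbK => con.
  by case: (connect_bichrom_ends okg' con cy qz yz).
pose A := ~: (q |: colors_at g x).
have AP c : c \in A -> c != q /\ c \notin colors_at g x.
  by rewrite in_setC in_setU1 negb_or => /andP[].
have AF c : c \in colors_at g x -> c \notin A.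
  by move=> cin; rewrite in_setC negbK in_setU1 cin orbT.
have Aq : q \notin A by rewrite in_setC negbK in_setU1 eqxx.
have cA : #|A| = D - 2.
  by rewrite (cardsC_colors cardC) cardsU1 qx cx; nat_lia.
have [con|//] : (forall c, c \in A -> connect (bichrom g c c4) x y) \/ colorable C e.
  apply: (@forall_or C) => c /AP[cq cx'].
  by apply: (attached_x_connect cub okg att) => //; apply: contraNneq cx' => ->.
have sAy : A \subset colors_at g y.
  apply/subsetP => c cin; have [_ cnx] := AP c cin.
  by case: (connect_bichrom_ends okg' (con c cin) cnx py xy).
have cy := card_colors_y cub okg.
have cz := card_colors_y (cubic_swap cub) okg.
have two : #|c1 |: (c2 |: A)| = D.
  by rewrite !cardsU1 in_setU1 negb_or n12 !AF // cA; nat_lia.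
(* If [q] were missing, [c1] and [c2] would both occur at [y] besides the [D - 2] colours of [A],
   one colour too many. *)
have qy : q \in colors_at g y.
  apply: contraT => nqy.
  have y1 : c1 \in colors_at g y.
    by apply: contraT => /(nattP _ c1x natt1) []; rewrite (negbTE nqy).
  have y2 : c2 \in colors_at g y.
    by apply: contraT => /(nattP _ c2x natt2) []; rewrite (negbTE nqy).
  have : #|c1 |: (c2 |: A)| <= #|colors_at g y|.
    by apply: subset_leq_card; rewrite !subUset !sub1set y1 y2.
  by rewrite two leqNgt cy.
have Ey : colors_at g y = q |: A.
  apply/esym/eqP; rewrite eqEcard subUset sub1set qy sAy cardsU1 Aq cA /=.
  by nat_lia.
have ny c : c \in colors_at g x -> c \notin colors_at g y.
  by move=> cin; rewrite Ey in_setU1 negb_or neq // AF.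
have [_ z1] := nattP _ c1x natt1 (ny _ c1x).
have [_ z2] := nattP _ c2x natt2 (ny _ c2x).
(* [z] has at most [D - 1] colours, among them [c1] and [c2], so the [D - 2] colours of [A] cannot
   all occur there. *)
have [|d dA] := @exists_in_notin C A (colors_at g z :\ c1 :\ c2).
  have := cardsD1 c1 (colors_at g z); have := cardsD1 c2 (colors_at g z :\ c1).
  by rewrite in_setD1 eq_sym n12 z1 z2 cA /=; nat_lia.
have [dq dx] := AP d dA.
have dc c : c \in colors_at g x -> d != c by move=> cin; apply: contraNneq dx => ->.
rewrite !in_setD1 !dc //= => dz.
(* The path from [y] in [c4] and [d] ends at [x], hence not at [z], so [d] may replace [q] at
   [vz]. *)
have att4 : attachable g y z c4 d.
  rewrite /attachable eq_sym dc // py dz /= connect_bichromC.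
  have := con d dA; rewrite connect_bichrom_sym // => conyx.
  apply: (bichrom_three_ends okg' _ _ _ _ _ _ conyx) => //; rewrite ?negb_and.
  - by rewrite py orbT.
  - by rewrite dx.
  - by rewrite dz.
  by rewrite eq_sym.
case: (attached_x_connect (r := q) cub okg att4 dx qx) => //; try by rewrite eq_sym.
move=> conq.
have Ew : colors_at g w = c4 |: ~: colors_at g x.
  apply/esym/eqP; rewrite eqEcard; apply/andP; split; last first.
    rewrite cardsU1 in_setC negbK c4x (cardsC_colors cardC) cx.
    by have := card_colors_le w okg; nat_lia.
  apply/subsetP => c; rewrite in_setU1 in_setC => /predU1P[->|cnx].
    by apply/colors_atP; exists x; rewrite gC.
  have [E|cq] := eqVneq c q.
    by subst c; case: (connect_bichrom_ends okg' conq cnx py xy) => _ _; apply.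
  have cin : c \in A by rewrite in_setC in_setU1 negb_or cq.
  by case: (connect_bichrom_ends okg' (con c cin) cnx py xy) => _ _; apply.
have cu s c : g x s = Some c -> c \in colors_at g s.
  by move=> xs; apply/colors_atP; exists x; rewrite gC.
case: (@exists_swappable C (~: colors_at g x) c1 c2 c3 (colors_at g u1)
  (colors_at g u2) (colors_at g u3) q) => //; try exact: cu;
  try by rewrite in_setC negbK.
  by rewrite (cardsC_colors cardC) cx; nat_lia.
move=> a []; rewrite in_setC => ax aq /or3P[] sw.
- exact: colorable_fan_shift okg fn att qx Ew ax aq sw.
- exact: colorable_fan_shift okg (fan_rot fn) att qx Ew ax aq sw.
exact: colorable_fan_shift okg (fan_rot (fan_rot fn)) att qx Ew ax aq sw.
Qed.

Lemma colorable_quintic_one g u1 u2 u3 w c1 c2 c3 c4 p q : partial_coloring g ->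
  fan g u1 u2 u3 w c1 c2 c3 c4 -> attachable g y z p q ->
  p \in colors_at g x -> q \notin colors_at g x -> 4 < D -> colorable C e.
Proof.
move=> okg fn att px qx D5; have [okg' _] := okg.
have cx := fan_card okg' fn; have [f1 f2 f3 f4 _ _ l1 l2 l3] := fn.
move: px; rewrite (fan_colors _ fn) !in_cons in_nil orbF.
case/or4P=> /eqP E; subst p.
- exact: (colorable_low okg att cx D5 qx f1).
- exact: (colorable_low okg att cx D5 qx f2).
- exact: (colorable_low okg att cx D5 qx f3).
exact: (colorable_fan_hub okg fn att).
Qed.

Lemma colors_at_saturated g : partial_coloring g -> #|colors_at g x| = 4 ->
  (forall c, c \notin colors_at g x -> c \in colors_at g y) ->
  colors_at g y = ~: colors_at g x.
Proof.
move=> okg cx H; apply/esym/eqP; rewrite eqEcard (cardsC_colors cardC) cx.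
apply/andP; split; last by have := card_colors_y cub okg; nat_lia.
by apply/subsetP => c; rewrite in_setC; apply: H.
Qed.

End Fan.

(** The new case has [p] and [q] at [x] and no colour missing at [x] and also at [y] or [z]. Then
    [y] and [z] see exactly the colours missing at [x], and any two colours at [x] are attachable.
    Choosing those of two low neighbours that miss a common candidate for [vx] leaves it
    unblocked. *)
Lemma colorable_quintic x y z g p q u1 u2 u3 w c1 c2 c3 c4 : cubic v x y z ->
  partial_coloring g -> fan x g u1 u2 u3 w c1 c2 c3 c4 ->
  attachable g y z p q -> 4 < D -> colorable C e.
Proof.
move=> cub okg fn att D5; have cub' := cubic_swap cub; have [okg' _] := okg.
have gC := colC okg'; have cx := fan_card okg' fn.
have att' : attachable g z y q p by rewrite -attachable_swap.
have [px|px] := boolP (p \in colors_at g x); have [qx|qx] := boolP (q \in colors_at g x).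
- have [/existsP[c /andP[ncx ncy]]|/existsPn Hy] :=
    boolP [exists c, (c \notin colors_at g x) && (c \notin colors_at g y)].
    case: (attachable_or_colorable cub okg att px qx ncx ncy) => // att2.
    rewrite attachable_swap // in att2.
    exact: (colorable_quintic_one cub' okg fn att2).
  have [/existsP[c /andP[ncx ncz]]|/existsPn Hz] :=
    boolP [exists c, (c \notin colors_at g x) && (c \notin colors_at g z)].
    case: (attachable_or_colorable cub' okg att' qx px ncx ncz) => // att2.
    rewrite attachable_swap // in att2.
    exact: (colorable_quintic_one cub okg fn att2).
  have Ey : colors_at g y = ~: colors_at g x.
    apply: (colors_at_saturated cub) => // c ncx.
    by have := Hy c; rewrite ncx negbK.
  have Ez : colors_at g z = ~: colors_at g x.
    apply: (colors_at_saturated cub') => // c ncx.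
    by have := Hz c; rewrite ncx negbK.
  have free s t c c' a : g x s = Some c -> g x t = Some c' -> c != c' ->
      a \notin colors_at g x -> a \notin colors_at g s -> a \notin colors_at g t ->
      colorable C e.
    move=> xs xt cc ax as' at'.
    have cinx := mem_colors_at xs; have cinx' := mem_colors_at xt.
    have ny d : d \in colors_at g x -> d \notin colors_at g y.
      by move=> din; rewrite Ey in_setC negbK.
    have nz d : d \in colors_at g x -> d \notin colors_at g z.
      by move=> din; rewrite Ez in_setC negbK.
    have att2 : attachable g y z c c'.
      rewrite /attachable cc ny // nz //=; apply: notin_bichrom_isolated => //; try exact: ny.
      exact: (cub_yz cub).
    have na d : d \in colors_at g x -> a != d by move=> din; apply: contraNneq ax => ->.
    apply: (colorable_cubic cub okg att2 ax (na _ cinx) (na _ cinx')).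
      apply/negP => H; case: (connect_bichrom_ends okg' H ax (ny _ cinx) (cub_xy cub)).
      by move=> _ _ /(_ s xs); rewrite (negbTE as').
    apply/negP => H; case: (connect_bichrom_ends okg' H ax (nz _ cinx') (cub_xz cub)).
    by move=> _ _ /(_ t xt); rewrite (negbTE at').
  have := fan_uniq_colors okg' fn; have [f1 f2 f3 f4 _ _ l1 l2 l3] := fn.
  rewrite /= !inE !negb_or !andbT.
  move=> /andP[/and3P[n12 n13 n14] /andP[/andP[n23 n24] n34]].
  have le2 s c : g x s = Some c -> #|colors_at g s| <= 3 ->
      #|colors_at g s :&: ~: colors_at g x| <= 2.
    move=> xs ls; apply: (card_setI_le_one_out ls (a := c)).
      by apply/colors_atP; exists x; rewrite gC.
    by rewrite in_setC negbK; apply: mem_colors_at xs.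
  have [||||a] := @exists_missing_two C (~: colors_at g x) (colors_at g u1)
    (colors_at g u2) (colors_at g u3).
  + by rewrite (cardsC_colors cardC) cx; nat_lia.
  + exact: le2 f1 l1.
  + exact: le2 f2 l2.
  + exact: le2 f3 l3.
  rewrite in_setC => ax /or3P[]/andP[a1 a2].
  + exact: free f1 f2 n12 ax a1 a2.
  + exact: free f1 f3 n13 ax a1 a2.
  exact: free f2 f3 n23 ax a1 a2.
- exact: (colorable_quintic_one cub okg fn att).
- exact: (colorable_quintic_one cub' okg fn att').
apply: (colorable_disjoint cub okg att) => //.
by rewrite cx; apply: ltnW.
Qed.

End Cubic.

(** * Discharging *)

Definition sparse (T : finType) (e : rel T) := forall S : {set T}, S != set0 ->
  #|induced_edges e S| <= 2 * #|S| - 1.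

Section Discharging.
Variables (T : finType) (e : rel T).
Hypotheses (eC : symmetric e) (ei : irreflexive e).

Lemma edgesP (f : {set T}) :
  reflect (exists x y, f = [set x; y] /\ e x y) (f \in edges e).
Proof.
apply: (iffP imset2P) => [[x y _]|[x [y [-> xy]]]].
  by rewrite inE => xy ->; exists x, y.
by exists x y; rewrite ?inE.
Qed.

Lemma neq_edge x y : e x y -> x != y.
Proof. by apply: contraTneq => ->; rewrite ei. Qed.

Lemma degree_incident x : degree e x = #|[set f in edges e | x \in f]|.
Proof.
rewrite /degree -(@card_in_imset _ _ (fun y => [set x; y])).
  congr #|pred_of_set _|; apply/setP => f; rewrite in_set; apply/imsetP/andP.
    case=> y; rewrite inE => xy ->; split; last by rewrite set21.
    by apply/edgesP; exists x, y.
  case=> /edgesP[s [t [-> st]]]; rewrite in_set2 => /orP[]/eqP ->.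
    by exists t => //; rewrite inE.
  by exists s; rewrite ?inE 1?eC // setUC.
move=> y z; rewrite !inE => xy xz E; have : y \in [set x; z] by rewrite -E set22.
by rewrite in_set2 eq_sym (negbTE (neq_edge xy)) => /eqP.
Qed.

(** Handshake lemma, by counting incidences. *)
Lemma sum_degree : \sum_x degree e x = 2 * #|edges e|.
Proof.
under eq_bigr do rewrite degree_incident -sum1_card.
under eq_bigr do under eq_bigl do rewrite inE.
rewrite (exchange_big_dep (mem (edges e))) /=; last by move=> x f _ /andP[].
rewrite mulnC -sum_nat_const; apply: eq_bigr => f /edgesP[x [y [-> xy]]].
rewrite sum1dep_card -[RHS]/(true.+1) -(neq_edge xy) -cards2.
congr #|pred_of_set _|; apply/setP => t; rewrite inE andb_idl // => _.
by apply/edgesP; exists x, y.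
Qed.

Lemma sum_nat_bool (P Q : pred T) : \sum_(t | P t) (Q t : nat) = #|[set t | P t & Q t]|.
Proof.
by rewrite -sum1dep_card big_mkcondr; apply: eq_bigr => t _; case: (Q t).
Qed.

(* A vertex of degree [d] starts with charge [3 d - 12] and receives [weight d] from
   each of its neighbours. *)
Definition weight d := if d == 2 then 3 else if d == 3 then 1 else 0.

Definition nb_high x := #|[set u | e x u & 3 < degree e u]|.
Definition nb_cubic x := #|[set u | e x u & degree e u == 3]|.

Definition reducible v := [|| degree e v == 1,
  (degree e v == 2) && [exists x, e v x && (nb_high x <= 3)] |
  (degree e v == 3) && [exists x, e v x && ((3 <= degree e x <= 4) ||
     (degree e x == 5) && (3 < nb_cubic x))]].

Lemma nb_high_le x : nb_high x <= degree e x.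
Proof. by apply: subset_leq_card; apply/subsetP => u; rewrite !inE => /andP[]. Qed.

Lemma nb_high_lt x u : e x u -> degree e u <= 3 -> nb_high x < degree e x.
Proof.
move=> xu du; rewrite /degree (cardsD1 u) inE xu ltnS; apply: subset_leq_card.
apply/subsetP => t; rewrite !inE => /andP[-> dt]; rewrite andbT.
by apply: contraTneq dt => ->; rewrite -leqNgt.
Qed.

(** Charge sent equals charge received, so the total is preserved. *)
Lemma sum_weight_nbr : \sum_x \sum_(u | e x u) weight (degree e u) =
  \sum_x degree e x * weight (degree e x).
Proof.
rewrite (exchange_big_dep predT) //=; apply: eq_bigr => u _.
rewrite sum_nat_const; congr muln; apply: eq_card => x.
by rewrite !inE unfold_in /= eC.
Qed.

(** Vertices of degree two, three and four send nothing and end with charge zero. For larger degree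
    [d], a neighbour of degree two forces four high neighbours, so at most [3 * (d - 4)] is sent;
    otherwise one unit goes to each cubic neighbour, at most three of them when [d = 5]. *)
Lemma discharge v : (forall u, ~~ reducible u) -> 0 < degree e v ->
  12 + \sum_(u | e v u) weight (degree e u) <=
  3 * degree e v + degree e v * weight (degree e v).
Proof.
move=> red dv.
have n1 : degree e v != 1 by apply: contra (red v) => H; rewrite /reducible H.
have no2 u x : e u x -> degree e u = 2 -> 3 < nb_high x.
  move=> ux du; rewrite ltnNge; apply: contra (red u) => H.
  by rewrite /reducible du /= orbF; apply/existsP; exists x; rewrite ux.
have no3 u x : e u x -> degree e u = 3 -> degree e x != 3 /\ degree e x != 4.
  move=> ux du; split; apply: contra (red u) => /eqP dx;
  by rewrite /reducible du /=; apply/existsP; exists x; rewrite ux dx.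
have no5 u x : e u x -> degree e u = 3 -> degree e x = 5 -> nb_cubic x <= 3.
  move=> ux du dx; rewrite leqNgt; apply: contra (red u) => H.
  by rewrite /reducible du /=; apply/existsP; exists x; rewrite ux dx H.
have w0 : (forall u, e v u -> degree e u != 2 /\ degree e u != 3) ->
    \sum_(u | e v u) weight (degree e u) = 0.
  move=> H; apply: big1 => u /H [/negbTE d2 /negbTE d3].
  by rewrite /weight d2 d3.
(* A neighbour of degree two would force four high neighbours of [v] and is not high itself. *)
have no2' u : e v u -> degree e v <= 4 -> degree e u != 2.
  move=> vu dv4; apply/eqP => du; rewrite eC in vu; have := no2 _ _ vu du.
  by rewrite eC in vu; have := nb_high_lt vu; rewrite du => /(_ isT); nat_lia.
have [d5|d5] := ltnP (degree e v) 5.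
  have : (degree e v == 2) || (degree e v == 3) || (degree e v == 4) by lia.
  move=> /orP[/orP[]|] /eqP Ed; rewrite w0 ?Ed // => u vu; split;
    try by apply: no2'; rewrite ?Ed.
  - by have := no2 _ _ vu Ed; have := nb_high_le u; lia.
  - by case: (no3 _ _ vu Ed).
  - by apply/eqP => du; rewrite eC in vu; case: (no3 _ _ vu du); rewrite Ed.
have -> : weight (degree e v) = 0 by rewrite /weight; case: (degree e v) d5 => [|[|[|[|]]]].
rewrite muln0 addn0.
have [/existsP[u /andP[vu /eqP du]]|/existsPn n2] := boolP [exists u, e v u && (degree e u == 2)].
  have vu' : e u v by rewrite eC.
  have hv := no2 _ _ vu' du.
  have : \sum_(u | e v u) weight (degree e u) <=
         \sum_(u | e v u) 3 * (degree e u <= 3).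
    apply: leq_sum => t _; rewrite /weight; case: eqP => [->|_] //.
    by case: eqP => [->|].
  rewrite -big_distrr /=.
  rewrite sum_nat_bool; set low := #|_|.
  have : nb_high v + low = degree e v.
    rewrite /degree -(cardsID [set t | 3 < degree e t]); congr addn;
      by apply: eq_card => t; rewrite !inE // -leqNgt andbC.
  nat_lia.
have : \sum_(u | e v u) weight (degree e u) <= nb_cubic v.
  rewrite -[nb_cubic v](sum_nat_bool (e v) (fun u => degree e u == 3)); apply: leq_sum => u vu; rewrite /weight.
  by have := n2 u; rewrite vu /= => /negbTE ->; case: eqP.
have : nb_cubic v <= degree e v.
  by apply: subset_leq_card; apply/subsetP => u; rewrite !inE => /andP[].
have [d6|d6] := ltnP 5 (degree e v); first by nat_lia.
have d5' : degree e v = 5 by lia.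
have [/existsP[u /andP[vu /eqP du]]|/existsPn n3] := boolP [exists u, e v u && (degree e u == 3)].
  have vu' : e u v by rewrite eC.
  by have := no5 _ _ vu' du d5'; nat_lia.
by rewrite w0 ?d5' // => u vu; have := n2 u; have := n3 u; rewrite vu.
Qed.

(** Without a reducible vertex, summing the final charges gives [12 * #|S| <= 6 * #|edges e|],
    against sparsity on [S]. *)
Lemma exists_reducible : sparse e ->
  [exists x, exists y, e x y] -> exists v, reducible v.
Proof.
move=> sp /existsP[x0 /existsP[y0 xy0]]; apply/existsP; apply: contraT.
rewrite negb_exists => /forallP red.
(* Isolated vertices are left out: their charge would be [-12]. *)
pose S := [set v | 0 < degree e v].
have degS u w : e u w -> u \in S.
  by move=> uw; rewrite inE /degree card_gt0; apply/set0Pn; exists w; rewrite inE.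
have S0 : S != set0 by apply/set0Pn; exists x0; apply: degS xy0.
have ES : induced_edges e S = edges e.
  apply/setP => f; rewrite inE andb_idr // => /edgesP[x [y [-> xy]]].
  by rewrite subUset !sub1set (degS _ _ xy) /= (degS y x) // eC.
have := sp S S0; rewrite ES.
have : \sum_(v in S) (12 + \sum_(u | e v u) weight (degree e u)) <=
       \sum_(v in S) (3 * degree e v + degree e v * weight (degree e v)).
  by apply: leq_sum => v; rewrite inE; apply: discharge.
rewrite big_split [X in _ <= X]big_split /= sum_nat_const.
have -> : \sum_(v in S) 3 * degree e v = 3 * \sum_(v in S) degree e v.
  by rewrite big_distrr.
have outS v : v \notin S -> degree e v = 0 by rewrite inE -eqn0Ngt => /eqP.
have restrict (F : T -> nat) : (forall v, v \notin S -> F v = 0) ->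
    \sum_(v in S) F v = \sum_v F v.
  by move=> F0; rewrite [RHS](bigID (mem S)) /= [X in _ = _ + X]big1 ?addn0.
rewrite (restrict (degree e)) //.
rewrite (restrict (fun v => \sum_(u | e v u) weight (degree e u))); last first.
  by move=> v vS; apply: big1 => u vu; rewrite (degS _ _ vu) in vS.
rewrite (restrict (fun v => degree e v * weight (degree e v))); last first.
  by move=> v /outS ->.
rewrite sum_weight_nbr sum_degree leq_add2r.
have : 0 < #|S| by rewrite card_gt0.
by move: #|S| #|edges e| => s m; nat_lia.
Qed.

End Discharging.

(** * Induction *)

Definition del_edge (T : finType) (e : rel T) (v x : T) : rel T :=
  fun s t => e s t && ~~ (((s == v) && (t == x)) || ((s == x) && (t == v))).

Section Reduction.
Variables (T C : finType) (D : nat) (e : rel T).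
Hypotheses (cardC : #|C| = D + 3) (eC : symmetric e) (ei : irreflexive e).
Hypothesis (degD : forall w, degree e w <= D).

Lemma degree1P v : degree e v = 1 -> exists x, forall w, e v w = (w == x).
Proof.
move/eqP/cards1P => [x E]; exists x => w.
by have /setP/(_ w) := E; rewrite !inE.
Qed.

Lemma degree2P v x : degree e v = 2 -> e v x ->
  exists2 y, x != y & forall w, e v w = (w == x) || (w == y).
Proof.
move=> dv vx; have /eqP/cards1P[y E] : #|[set u | e v u] :\ x| = 1.
  by have := cardsD1 x [set u | e v u]; rewrite inE vx -/(degree e v) dv => -[].
exists y.
  have : y \in [set u | e v u] :\ x by rewrite E set11.
  by rewrite !inE eq_sym => /andP[].
move=> w; have /setP/(_ w) := E; rewrite !inE => <-.
by case: eqP => [->|].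
Qed.

Lemma degree3P v x : degree e v = 3 -> e v x -> exists y z, cubic e v x y z.
Proof.
move=> dv vx; have /eqP/cards2P[y [z [yz E]]] : #|[set u | e v u] :\ x| = 2.
  by have := cardsD1 x [set u | e v u]; rewrite inE vx -/(degree e v) dv => -[].
have xn t : t \in [set y; z] -> x != t.
  by rewrite -E !inE eq_sym => /andP[].
exists y, z; split=> //.
- move=> w; have /setP/(_ w) := E; rewrite !inE => <-.
  by case: eqP => [->|].
- by apply: xn; rewrite set21.
- by apply: xn; rewrite set22.
Qed.

(** Starting from [G - vx] rather than [G - v] provides the attachable pair: a path from [y] to [z]
    in [p] and [q] avoiding [v] would close a cycle through [v]. *)
Lemma attachable_from_del_edge f v x y z : acyclic_coloring f ->
  covers f (del_edge e v x) -> cubic e v x y z ->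
  @partial_coloring T C e v (delete f v) /\
  exists p q, attachable (delete f v) y z p q.
Proof.
move=> okf fe [Nv xy xz yz]; have vx : e v x by rewrite Nv eqxx.
have edge t : e v t -> x != t -> exists c, f v t = Some c.
  move=> vt xt; have := fe v t; rewrite /del_edge vt eqxx /= [t == x]eq_sym (negbTE xt) /=.
  have /negbTE -> : v != x by apply: contraTneq vx => ->; rewrite ei.
  by case: (f v t) => // c _; exists c.
split.
  split; first exact: acyclic_coloring_delete.
  move=> s t; rewrite (covers_del_vertex v fe) /del_vertex /del_edge.
  by case: (s == v); case: (t == v); rewrite ?andbF //= andbT.
have vy : e v y by rewrite Nv eqxx orbT.
have vz : e v z by rewrite Nv eqxx !orbT.
have [p fy] := edge y vy xy; have [q fz] := edge z vz xz.
exists p, q; apply/and4P; split.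
- by apply: contraNneq yz => E; rewrite E in fy; rewrite (col_inj okf fy fz).
- exact: notin_colors_at_delete okf fy.
- exact: notin_colors_at_delete okf fz.
apply: (connect_delete_forbidden okf fy fz yz).
by apply: contraTneq vy => ->; rewrite ei.
Qed.

(** [v] is itself one of the at least four cubic neighbours of [x], so three others remain among the
    four neighbours of [x] in [G - v]. *)
Lemma fan_exists g v x : covers g (del_vertex e v) -> e v x -> degree e v = 3 ->
  degree e x = 5 -> 3 < nb_cubic e x ->
  exists u1 u2 u3 w c1 c2 c3 c4, @fan T C x g u1 u2 u3 w c1 c2 c3 c4.
Proof.
move=> ge vx dv dx n3; have xv : e x v by rewrite eC.
have nvx : x != v by apply: contraTneq vx => ->; rewrite ei.
have [N NP cN] : exists2 N : {set T}, forall u, (u \in N) = (u != v) && e x u & #|N| = 4.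
  exists ([set u | e x u] :\ v); first by move=> u; rewrite !inE.
  by have := cardsD1 v [set u | e x u]; rewrite inE xv -/(degree e x) dx => -[].
have : 2 < #|[set u | e x u & degree e u == 3] :\ v|.
  have := cardsD1 v [set u | e x u & degree e u == 3].
  by rewrite inE xv dv eqxx /= -/(nb_cubic e x) => H; rewrite H in n3.
case/card_gt2P=> u1 [u2 [u3 [[i1 i2 i3] [n12 n23 n31]]]].
have mem u : u \in [set u | e x u & degree e u == 3] :\ v -> u \in N /\ degree e u = 3.
  by rewrite NP !inE => /and3P[-> -> /eqP].
have [N1 d1] := mem _ i1; have [N2 d2] := mem _ i2; have [N3 d3] := mem _ i3.
have /cards1P[w Ew] : #|N :\ u1 :\ u2 :\ u3| == 1.
  have := cardsD1 u1 N; have := cardsD1 u2 (N :\ u1).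
  have := cardsD1 u3 (N :\ u1 :\ u2).
  rewrite !in_setD1 N1 N2 N3 n31 [u2 == u1]eq_sym n12 [u3 == u2]eq_sym n23 cN /=.
  by nat_lia.
have : w \in N :\ u1 :\ u2 :\ u3 by rewrite Ew set11.
rewrite !in_setD1 => /and4P[w3 w2 w1 Nw].
have edge t : t \in N -> exists c, g x t = Some c.
  rewrite NP => /andP[tv xt]; have := ge x t; rewrite /del_vertex nvx tv xt.
  by case: (g x t) => // c _; exists c.
have [c1 f1] := edge _ N1; have [c2 f2] := edge _ N2.
have [c3 f3] := edge _ N3; have [c4 f4] := edge _ Nw.
exists u1, u2, u3, w, c1, c2, c3, c4; split=> //.
- by rewrite /= !inE !negb_or n12 n23 [u1 == u3]eq_sym n31 ![_ == w]eq_sym w1 w2 w3.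
- move=> t c xt; have : t \in N.
    have := ge x t; rewrite xt /del_vertex /= => /esym /and3P[_ tv et].
    by rewrite NP tv et.
  move=> tN; rewrite !in_cons in_nil orbF; apply: contraT; rewrite !negb_or.
  move=> /and4P[t1 t2 t3]; have : t \in N :\ u1 :\ u2 :\ u3 by rewrite !in_setD1 t1 t2 t3.
  by rewrite Ew in_set1 => ->.
- by have := card_colors_at_del u1 ge; rewrite d1; nat_lia.
- by have := card_colors_at_del u2 ge; rewrite d2; nat_lia.
- by have := card_colors_at_del u3 ge; rewrite d3; nat_lia.
Qed.

Lemma colorable_reducible v : reducible e v ->
  (forall x, e v x -> colorable C (del_vertex e v)) ->
  (forall x, e v x -> colorable C (del_edge e v x)) -> colorable C e.
Proof.
move=> red IHv IHe; case/or3P: red.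
- move/eqP/degree1P => [x Nv]; apply: (colorable_deg1 cardC eC ei degD Nv).
  by apply: (IHv x); rewrite Nv.
- case/andP=> /eqP dv /existsP[x /andP[vx hx]].
  have [y xy Nv] := degree2P dv vx.
  exact: (colorable_deg2 cardC eC ei degD xy Nv hx (IHv x vx)).
case/andP=> /eqP dv /existsP[x /andP[vx hx]].
have [y [z cub]] := degree3P dv vx; have [f [okf fe]] := IHe x vx.
have [okg [p [q att]]] := attachable_from_del_edge okf fe cub.
case/orP: hx => [/andP[_ dx]|/andP[/eqP dx n3]].
  (* Here [2 < D] because [v] has degree three. *)
  apply: (colorable_quartic cardC eC ei degD cub okg att); last by rewrite -dv.
  have := card_colors_at_del x (proj2 okg); rewrite eC vx addn1 => H.
  exact: leq_trans H dx.
have [u1 [u2 [u3 [w [c1 [c2 [c3 [c4 fn]]]]]]]] := fan_exists (proj2 okg) vx dv dx n3.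
by apply: (colorable_quintic cardC eC ei degD cub okg fn att); rewrite -dx.
Qed.

End Reduction.

Lemma sparse_sub (T : finType) (e e' : rel T) :
  subrel e' e -> sparse e -> sparse e'.
Proof.
move=> sub sp S S0; apply: leq_trans (sp S S0); apply: subset_leq_card.
apply/subsetP => f; rewrite !inE => /andP[/edgesP[x [y [-> xy]]] ->].
by rewrite andbT; apply/edgesP; exists x, y; split=> //; apply: sub.
Qed.

Lemma degree_sub (T : finType) (e e' : rel T) x :
  subrel e' e -> degree e' x <= degree e x.
Proof.
by move=> sub; apply: subset_leq_card; apply/subsetP => u; rewrite !inE; apply: sub.
Qed.

(** The induction counts ordered adjacent pairs and keeps [D] and [C] fixed while the maximum degree
    may drop; a deleted vertex stays as an isolated one. *)
Lemma colorable_sparse (T C : finType) (D : nat) (e : rel T) : #|C| = D + 3 ->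
  symmetric e -> irreflexive e -> (forall w, degree e w <= D) -> sparse e ->
  colorable C e.
Proof.
move=> cardC; have [n] := ubnP #|[set p | e p.1 p.2]|.
elim: n e => // n IH e size_e eC ei degD sp.
have [nonempty|empty] := boolP [exists x, exists y, e x y]; last first.
  exists (fun _ _ => None); split; last first.
    move=> x y; apply/esym/negbTE; apply: contra empty => xy.
    by apply/existsP; exists x; apply/existsP; exists y.
  by split=> // a b [|x s] //= _; case: s.
have [v red] := exists_reducible eC ei sp nonempty.
have smaller (e' : rel T) x : subrel e' e -> symmetric e' -> e v x -> ~~ e' v x ->
    colorable C e'.
  move=> sub eC' vx nvx; apply: IH => //.
  - rewrite -ltnS; apply: leq_trans size_e; rewrite ltnS; apply: proper_card.
    apply/properP; split; last by exists (v, x); rewrite !inE.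
    by apply/subsetP => -[s t]; rewrite !inE; apply: sub.
  - by move=> t; apply/negbTE; apply/negP => /sub; rewrite ei.
  - by move=> w; apply: leq_trans (degree_sub w sub) (degD w).
  - exact: sparse_sub sub sp.
apply: (colorable_reducible cardC eC ei degD red) => x vx.
  apply: (smaller _ x) => //.
  - by move=> s t /and3P[].
  - by move=> s t; rewrite /del_vertex eC; case: (s == v); case: (t == v).
  - by rewrite /del_vertex eqxx.
apply: (smaller _ x) => //.
- by move=> s t /andP[].
- by move=> s t; rewrite /del_edge eC orbC; congr (_ && ~~ (_ || _)); apply: andbC.
by rewrite /del_edge !eqxx andbF.
Qed.

(** * From colours of vertex pairs to colours of edge sets *)

Section ToEdges.
Variables (T : finType) (k : nat) (e : rel T).
Hypotheses (eC : symmetric e) (ei : irreflexive e).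
Variable f : T -> T -> option 'I_k.
Hypotheses (okf : acyclic_coloring f) (fe : covers f e).

(** By symmetry of [f] the choice of orientation does not matter on edges; sets that are not edges
    get the default 0. *)
Definition edge_color (S : {set T}) : nat :=
  if [pick p : T * T | (S == [set p.1; p.2]) && (f p.1 p.2 != None)] is Some p
  then oapp val 0 (f p.1 p.2) else 0.

Lemma edge_colorE x y : e x y ->
  exists2 c : 'I_k, f x y = Some c & edge_color [set x; y] = c.
Proof.
move=> xy; have := fe x y; rewrite xy; case Ef: (f x y) => [c|//] _.
exists c => //; rewrite /edge_color; case: pickP => [[s t] /= /andP[/eqP E fst]|].
  have st : e s t by rewrite -fe.
  have nst := neq_edge ei st; have nxy := neq_edge ei xy.
  have : s \in [set x; y] by rewrite E set21.
  have : t \in [set x; y] by rewrite E set22.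
  rewrite !in_set2 => /orP[]/eqP ? /orP[]/eqP ?; subst s t; rewrite ?eqxx // in nst *.
  - by rewrite (colC okf) Ef.
  - by rewrite Ef.
by move/(_ (x, y)); rewrite /= eqxx Ef.
Qed.

Lemma acyclic_edge_colorable_of : acyclic_edge_colorable e k.
Proof.
exists edge_color; split; first by move=> _ /edgesP[x [y [-> /edge_colorE[c _ ->]]]].
split.
  move=> _ _ /edgesP[x [y [-> xy]]] /edgesP[s [t [-> st]]] ne.
  rewrite -setI_eq0 => /set0Pn[w]; rewrite inE => /andP[wxy wst].
  have orient a b : e a b -> w \in [set a; b] ->
      exists2 b', [set a; b] = [set w; b'] & e w b'.
    move=> ab; rewrite in_set2 => /orP[]/eqP ->; first by exists b.
    by exists a; [rewrite setUC|rewrite eC].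
  have [y' E1 wy] := orient _ _ xy wxy; have [t' E2 wt] := orient _ _ st wst.
  move: ne; rewrite E1 E2; apply: contraNneq.
  have [c fc ->] := edge_colorE wy; have [c' fc' ->] := edge_colorE wt.
  by move/val_inj => E; rewrite E in fc; rewrite (col_inj okf fc fc').
case=> p [sp up cp [a [b ab]]].
have [x0 x0p] : exists x0, x0 \in p by case: p sp {up cp ab} => // x p _; exists x; rewrite mem_head.
(* The naturals [a] and [b] need not be below [k]. The colour [d] of an edge of the cycle serves as
   default for [insubd], which preserves every colour occurring on the cycle. *)
have [d _ _] := edge_colorE (next_cycle cp x0p).
apply/negP: (col_acyclic okf (insubd d a) (insubd d b) up sp); rewrite negbK.
apply: cycle_from_next => // x xp; have [c fc ec] := edge_colorE (next_cycle cp xp).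
have := ab x xp; rewrite ec !inE /bichrom fc => /orP[]/eqP <-; by rewrite valKd eqxx ?orbT.
Qed.

End ToEdges.

Theorem theorem1 (T : finType) (e : rel T) :
  simple_graph e ->
  (forall S : {set T}, S != set0 ->
     #|induced_edges e S| <= 2 * #|S| - 1) ->
  acyclic_edge_colorable e (max_degree e + 3).
Proof.
move=> [eC ei] sp.
have [||f [okf fe]] := @colorable_sparse T 'I_(max_degree e + 3) (max_degree e) e _ eC ei _ sp.
- exact: card_ord.
- by move=> w; apply: leq_bigmax.
exact: acyclic_edge_colorable_of okf fe.
Qed.
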